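(* There exists at least one admissible candidate $\tilde{\mathbf e}=(\tilde e_1,\dots,\tilde e_m)$ that minimizes, over all admissible candidates $\mathbf e$, the functional $$l(\mathbf e)=\int g(\mathbf x)\log\frac{g(\mathbf x)}{\sum_{j=1}^m(\mathcal N_he_j)(\mathbf x)}\,d\mathbf x+\int\sum_{j=1}^m e_j(\mathbf x)\,d\mathbf x .$$ The same is true in the discrete case: for any sample points $\mathbf x_1,\dots,\mathbf x_n$ in the interior of $\Omega$ there exists at least one admissible candidate minimizing, over all admissible candidates, $$l_{\mathrm{discrete}}(\mathbf e)=-\frac1n\sum_{i=1}^n\log\sum_{j=1}^m(\mathcal N_he_j)(\mathbf x_i)+\int\sum_{j=1}^m e_j(\mathbf x)\,d\mathbf x .$$
   Context: Setting. $\Omega=[a,b]^r\subset\mathbb R^r$ with $a<b$, and $m$ is a fixed positive integer. $g$ is a probability density on $\mathbb R^r$ with support in the interior of $\Omega$, of the form $g=\sum_{j=1}^m e_j^*$ with $e_j^*(\mathbf x)=\theta_j^*\prod_{k=1}^r e^*_{j,k}(x_k)$, $\theta_j^*>0$, $e_{j,k}^*\in L^1(\mathbb R)$ nonnegative with support in $[a,b]$. Kernel. For a fixed bandwidth $h$, $s_h\in L^1(\mathbb R\times\mathbb R)$ is nonnegative, with support in $[a,b]\times[a,b]$, such that: $\int s_h(v,u)\,du=\int s_h(u,z)\,du=1$ for all $v,z\in[a,b]$; there are positive constants $M_1(h),M_2$ with $M_1(h)\le s_h(v,z)\le M_2$ for all $v,z\in[a,b]$; and $s_h$ has continuous first-order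 partial derivatives on $(a,b)\times(a,b)$, both bounded in absolute value by a constant $B$. Smoothing. $\tilde s_h(\mathbf x,\mathbf u)=\prod_{k=1}^r s_h(x_k,u_k)$; $(S_h^*f)(\mathbf x)=\int\tilde s_h(\mathbf u,\mathbf x)f(\mathbf u)\,d\mathbf u$; $(\mathcal N_hf)(\mathbf x)=\exp[(S_h^*\log f)(\mathbf x)]$ for $\mathbf x\in\Omega$ and $0$ elsewhere (integrals against $\tilde s_h$ are effectively over $\Omega$). Admissible candidates. $\mathbf e=(e_1,\dots,e_m)$ is admissible if for each $j$: (ii) $e_j(\mathbf x)=\theta_j\prod_{k=1}^r e_{j,k}(x_k)$ with $\theta_j>0$ and each $e_{j,k}\in L^1(\mathbb R)$ positive on $[a,b]$ and zero outside $[a,b]$; and (vi) $f_j=e_j/\int e_j$ satisfies $f_j(\mathbf x)\ge(M_1(h))^r$ for all $\mathbf x\in\Omega$. It is not required that $\sum_je_j=g$ or that $\sum_j e_j$ integrate to one. $l$ is regarded as taking values in $(-\infty,+\infty]$. *)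

(* Defs.v *)
From HB Require Import structures.
From mathcomp Require Import all_boot all_order all_algebra.
From mathcomp Require Import all_classical all_reals all_analysis.

Set Implicit Arguments.
Unset Strict Implicit.
Unset Printing Implicit Defensive.
Import Order.TTheory GRing.Theory Num.Theory.
Import numFieldNormedType.Exports.

Local Open Scope classical_set_scope.
Local Open Scope ring_scope.

(* Points of R^r are r-tuples of reals: in the library tuples carry the product
   sigma-algebra, here over the Borel sigma-algebra of [measurableTypeR R]. *)
Notation pt R r := (r.-tuple (measurableTypeR R)).

Section LebesgueTuple.
Context {R : realType}.

Definition consp n (p : measurableTypeR R * pt R n) : pt R n.+1 :=
  [the n.+1.-tuple _ of p.1 :: p.2].

Lemma measurable_consp n : measurable_fun [set: _] (@consp n).
Proof. exact: measurable_cons. Qed.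

Section step.
Variables (n : nat) (mu : {sigma_finite_measure set (pt R n) -> \bar R}).

Definition leb_step : set (pt R n.+1) -> \bar R :=
  pushforward (lebesgue_measure \x mu)%E (@consp n).

Let mF A : measurable A -> measurable (@consp n @^-1` A).
Proof. by move=> mA; rewrite -[X in measurable X]setTI; exact: measurable_consp. Qed.

Let leb_step0 : leb_step set0 = 0%E.
Proof. by rewrite /leb_step /pushforward preimage_set0 measure0. Qed.

Let leb_step_ge0 A : (0 <= leb_step A)%E.
Proof. by rewrite /leb_step /pushforward; apply: measure_ge0. Qed.

Let leb_step_sigma_additive : semi_sigma_additive leb_step.
Proof.
move=> F mF' tF mUF; rewrite /leb_step /pushforward preimage_bigcup.
apply: measure_semi_sigma_additive.
- by move=> i; exact: mF.
- apply/trivIsetP => /= i j _ _ ij; rewrite -preimage_setI.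
  by move/trivIsetP : tF => /(_ _ _ _ _ ij) ->//; rewrite preimage_set0.
- by rewrite -preimage_bigcup; exact: mF.
Qed.

HB.instance Definition _ := isMeasure.Build _ _ _ leb_step
  leb_step0 leb_step_ge0 leb_step_sigma_additive.

Let leb_step_sigma_finite : sigma_finite [set: pt R n.+1] leb_step.
Proof.
have /sigma_finiteP[F [FT Fnd Foo]] := sigma_finiteT (@lebesgue_measure R).
have /sigma_finiteP[G [GT Gnd Goo]] := sigma_finiteT mu.
pose u (t : pt R n.+1) : measurableTypeR R * pt R n :=
  (thead t, [tuple of behead t]).
have mu_ : measurable_fun [set: _] u.
  by apply/measurable_fun_pair; [exact: measurable_tnth|exact: measurable_behead].
have uK p : u (consp p) = p.
  by case: p => a t; rewrite /u /consp theadE; congr pair; exact/val_inj.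
exists (fun i => u @^-1` (F i `*` G i)).
  apply/seteqP; split => // t _.
  have [] : setT (u t).1 /\ setT (u t).2 by [].
  rewrite FT GT => -[i _ Fi] [j _ Gj]; exists (maxn i j) => //; split.
    by move: Fi; exact/subsetPset/Fnd/leq_maxl.
  by move: Gj; exact/subsetPset/Gnd/leq_maxr.
move=> i; have [mFi Fioo] := Foo i; have [mGi Gioo] := Goo i; split.
  rewrite -[X in measurable X]setTI; apply: mu_ => //; exact: measurableX.
rewrite /leb_step /pushforward (_ : _ @^-1` _ = F i `*` G i).
  by rewrite product_measure1E// lte_mul_pinfty// ge0_fin_numE.
by rewrite -comp_preimage (_ : u \o _ = id)//; apply/funext => p; exact: uK.
Qed.

HB.instance Definition _ := Measure_isSigmaFinite.Build _ _ _ leb_step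
  leb_step_sigma_finite.

End step.

(* r-dimensional Lebesgue measure: iterated product of [lebesgue_measure]. *)
Fixpoint leb n : {sigma_finite_measure set (pt R n) -> \bar R} :=
  if n is k.+1 then leb_step (leb k) else \d_[tuple].

Lemma leb_box n (A : 'I_n -> set (measurableTypeR R)) :
  (forall i, measurable (A i)) ->
  leb n [set t | forall i, A i (tnth t i)] = (\prod_i lebesgue_measure (A i))%E.
Proof.
elim: n A => [|n IH] A mA.
  rewrite big_ord0 /= /dirac (_ : [set _ | _] = setT) ?indicT//.
  by apply/seteqP; split => // t _ [].
rewrite big_ord_recl /= /leb_step /pushforward.
rewrite [X in product_measure1 _ _ X](_ : _ =
   A ord0 `*` [set t | forall i, A (lift ord0 i) (tnth t i)]); last first.
  apply/seteqP; split => -[a t] /=.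
    move=> H; split; first exact: (H ord0).
    by move=> i; have := H (lift ord0 i); rewrite tnthS.
  move=> [a0 H] i; case: (unliftP ord0 i) => [j|] -> //.
  by rewrite tnthS.
rewrite product_measure1E//; first by rewrite (IH (fun i => A (lift ord0 i))).
rewrite (_ : [set _ | _] =
   \bigcap_i ((fun t : pt R n => tnth t i) @^-1` A (lift ord0 i))).
  apply: fin_bigcap_measurable => //= i _.
  by rewrite -[X in measurable X]setTI; exact: measurable_tnth.
by apply/seteqP; split => t H i; [move=> _; exact: H|exact: (H i I)].
Qed.

End LebesgueTuple.

Section Model.
Context {R : realType}.
Implicit Types (a b : R) (s : R -> R -> R).

Definition L1 (f : R -> R) :=
  (@lebesgue_measure R).-integrable [set: measurableTypeR R] (EFin \o f).

Definition cube r a b : set (pt R r) :=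
  [set x | forall k, tnth x k \in `[a, b]].

(* The library puts the topology of R^r on row vectors, not on tuples. *)
Definition row_of r (x : pt R r) : 'rV[R]_r := \row_k tnth x k.

Definition icube r a b : set (pt R r) :=
  [set x | interior (@row_of r @` cube a b) (row_of x)].

Definition tsupport r (f : pt R r -> R) : set (pt R r) :=
  [set x | closure (@row_of r @` [set y | f y != 0]) (row_of x)].

Definition product_form r (th : R) (ek : 'I_r -> R -> R) (x : pt R r) : R :=
  th * \prod_(k < r) ek k (tnth x k).

Record target_density r m a b (g : pt R r -> R) : Prop := {
  td_mixture : exists (th : 'I_m -> R) (ek : 'I_m -> 'I_r -> R -> R),
    [/\ forall j, 0 < th j,
        forall j k, L1 (ek j k),
        forall j k t, 0 <= ek j k t,
        forall j k t, t \notin `[a, b] -> ek j k t = 0 &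
        forall x, g x = \sum_(j < m) product_form (th j) (ek j) x];
  td_density : (\int[leb r]_x (g x)%:E = 1)%E;
  td_support : tsupport g `<=` icube a b }.

(* [s] is the kernel s_h at the fixed bandwidth h; [M1] stands for M_1(h). *)
Record smoothing_kernel a b (M1 M2 B : R) s : Prop := {
  sk_L1 : (lebesgue_measure \x lebesgue_measure)%E.-integrable
    [set: measurableTypeR R * measurableTypeR R] (fun p => (s p.1 p.2)%:E);
  sk_ge0 : forall v z, 0 <= s v z;
  sk_support : forall v z,
    ~~ ((v \in `[a, b]) && (z \in `[a, b])) -> s v z = 0;
  sk_int2 : forall v, v \in `[a, b] ->
    (\int[lebesgue_measure]_u (s v u)%:E = 1)%E;
  sk_int1 : forall z, z \in `[a, b] ->
    (\int[lebesgue_measure]_u (s u z)%:E = 1)%E;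
  sk_M1 : 0 < M1;
  sk_M2 : 0 < M2;
  sk_bounds : forall v z, v \in `[a, b] -> z \in `[a, b] -> M1 <= s v z <= M2;
  sk_derivable : forall v z, v \in `]a, b[ -> z \in `]a, b[ ->
    derivable (fun t => s t z) v 1 /\ derivable (fun t => s v t) z 1;
  sk_C1 : forall v z, v \in `]a, b[ -> z \in `]a, b[ ->
    {for (v, z), continuous (fun p : R * R => derive1 (fun t => s t p.2) p.1)} /\
    {for (v, z), continuous (fun p : R * R => derive1 (fun t => s p.1 t) p.2)};
  sk_C1_bound : forall v z, v \in `]a, b[ -> z \in `]a, b[ ->
    `|derive1 (fun t => s t z) v| <= B /\ `|derive1 (fun t => s v t) z| <= B }.

Definition prod_kernel r s (x u : pt R r) : R :=
  \prod_(k < r) s (tnth x k) (tnth u k).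

(* S_h^* acts on extended-real functions, so that log 0 = -oo is allowed. *)
Definition adj_smooth r s (F : pt R r -> \bar R) (x : pt R r) : \bar R :=
  (\int[leb r]_u ((prod_kernel s u x)%:E * F u))%E.

(* [fine] is harmless: S_h^* (log f) < +oo whenever f is integrable on the cube. *)
Definition nl_smooth r a b s (f : pt R r -> R) (x : pt R r) : R :=
  if x \in cube a b then
    fine (expeR (adj_smooth s (fun u => lne (f u)%:E) x))
  else 0.

Definition admissible r m a b (M1 : R) (e : 'I_m -> pt R r -> R) : Prop :=
  forall j : 'I_m,
    (exists (th : R) (ek : 'I_r -> R -> R),
      [/\ 0 < th,
          forall k, L1 (ek k),
          forall k t, t \in `[a, b] -> 0 < ek k t,
          forall k t, t \notin `[a, b] -> ek k t = 0 &
          forall x, e j x = product_form th ek x]) /\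
    (forall x, cube a b x -> M1 ^+ r <= e j x / \int[leb r]_y e j y).

(* Where g = 0 the first integrand is 0 (convention 0 log 0 = 0; this covers the
   complement of the cube, where the denominator vanishes too). For admissible
   e the denominator is positive on the cube. The value may be +oo. *)
Definition loss r m a b s (g : pt R r -> R) (e : 'I_m -> pt R r -> R) : \bar R :=
  (\int[leb r]_x (g x * ln (g x / \sum_(j < m) nl_smooth a b s (e j) x))%:E
   + \int[leb r]_x (\sum_(j < m) e j x)%:E)%E.

Definition loss_discrete r m n a b s (X : 'I_n -> pt R r)
    (e : 'I_m -> pt R r -> R) : \bar R :=
  ((- (n%:R^-1 * \sum_(i < n) ln (\sum_(j < m) nl_smooth a b s (e j) (X i))))%:E
   + \int[leb r]_x (\sum_(j < m) e j x)%:E)%E.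

End Model.

(* Main.v *)
Require Import Defs.
From mathcomp Require Import all_boot all_order all_algebra.
From mathcomp Require Import all_classical all_reals all_analysis.
From mathcomp Require Import measurable_realfun ring lra.
Import Order.TTheory GRing.Theory Num.Theory.
Import numFieldNormedType.Exports.

(* Normalising each component, a candidate of total mass 1 amounts to weights [c j]
   on the simplex and log-densities [w j k] on ]a, b[ with lower bounds [al j k]
   such that [\sum_k al j k >= r ln M1]; smoothing only sees the functions
   [x |-> \int s(u, x) w(u) du], which are equibounded and equi-Lipschitz.  Along a
   maximizing sequence these converge uniformly (Tychonoff plus a finite net).  The
   uniform limit is again the smoothing of such a [w]: the functions [v >= alpha - eps]
   with [\int exp v <= 1] whose smoothing is eps-close to the limit form nested convex
   sets, and almost minimizers of the strongly convex functional [\int exp v] on them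
   are Cauchy in L1.  The limit [w] only satisfies [\int exp w <= 1], and limit weights
   may vanish; renormalising [exp w] increases the smoothed density, and a component of
   weight 0 can be replaced by a copy of another one whose weight is shared. *)

Local Open Scope classical_set_scope.
Local Open Scope ring_scope.

(** Log-densities are bounded below but not above, so a maximizing sequence of them need not
    converge; only the smoothings are uniformly controlled. Hence the limit object is rebuilt from
    its smoothing rather than extracted from the sequence. The constraint [\int exp v <= 1] is
    relaxed because it is convex and survives Fatou, whereas [\int exp v = 1] does neither. Up to
    the entropy of [g] in the first one, both functionals are the total mass minus [T] of the log of
    the smoothed mixture, where [T] averages against [g] or over the sample. All that is asked of
    [T] is monotonicity and letting additive constants through, so one existence argument serves
    both cases. If the entropy of [g] is infinite, the first functional is identically [+oo]. The
    work is done on the open box: the derivatives of the kernel are controlled only there, and the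
    support of [g] and the sample points lie inside it. *)

Section Auxiliary.
Set Implicit Arguments.
Unset Strict Implicit.
Unset Printing Implicit Defensive.

(** The gap is the square of [expR (q / 2) - expR (p / 2)]. For [p <= q] this difference is at least
    [expR (p / 2) * (q - p) / 2], because the exponential lies above its tangent, and
    [expR p >= expR L]. *)
Lemma expR_strongly_convex {R : realType} (L p q : R) : L <= p -> L <= q ->
  2 * expR ((p + q) / 2) + expR L / 4 * (p - q) ^+ 2 <= expR p + expR q.
Proof.
wlog pq : p q / p <= q.
  move=> H Lp Lq; have [pq|/ltW qp] := leP p q; first exact: H.
  by rewrite (addrC p) (addrC (expR p)) -(opprB q) sqrrN H.
move=> Lp Lq.
have e2 (t : R) : expR t = expR (t / 2) ^+ 2 by rewrite expr2 -expRD -splitr.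
have -> : expR ((p + q) / 2) = expR (p / 2) * expR (q / 2).
  by rewrite -expRD mulrDl.
have : expR L <= expR p by rewrite ler_expR.
rewrite (e2 p) (e2 q); set x := expR (p / 2); set y := expR (q / 2) => Lx.
have yx : x * (1 + (q - p) / 2) <= y.
  rewrite /y (_ : q / 2 = p / 2 + (q - p) / 2) ?expRD; last lra.
  by rewrite ler_wpM2l ?expR_ge0 ?expR_ge1Dx.
have x0 : 0 <= x by exact: expR_ge0.
have d0 : 0 <= q - p by rewrite subr_ge0.
have h1 : 0 <= x * ((q - p) / 2) by rewrite mulr_ge0// divr_ge0.
have h2 : (x * ((q - p) / 2)) ^+ 2 <= (y - x) ^+ 2.
  by rewrite ler_sqr ?nnegrE//; lra.
have h3 : expR L * (q - p) ^+ 2 <= x ^+ 2 * (q - p) ^+ 2.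
  by rewrite ler_wpM2r// sqr_ge0.
nra.
Qed.

(** * Almost everywhere limits of sequences with summable L1 increments *)

Section SummableIncrements.
Context d (T : measurableType d) (R : realType).
Context (mu : {measure set T -> \bar R}) (D : set T).
Context (mD : measurable D) (muD : (mu D < +oo)%E).
Implicit Types (u v w : T -> R).

Lemma integrable_cst_finite (c : R) : mu.-integrable D (EFin \o cst c).
Proof. by apply: measurable_bounded_integrable => //; exact: bounded_cst. Qed.

Lemma integrable_expR v : measurable_fun setT v ->
  (\int[mu]_(x in D) (expR (v x))%:E <= 1)%E ->
  mu.-integrable D (EFin \o (fun x => expR (v x))).
Proof.
move=> mv v1; apply/integrableP; split.
  by apply/measurable_EFinP; apply: measurableT_comp => //; exact: measurable_funTS.
rewrite (eq_integral (fun x => (expR (v x))%:E)); last first.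
  by move=> x _ /=; rewrite ger0_norm// expR_ge0.
by rewrite (le_lt_trans v1)// ltry.
Qed.

(** The majorant is [expR v + |L|]: the exponential controls the positive part of [v] and [L] the
    negative part. *)
Lemma integrable_log_density (L : R) v : measurable_fun setT v ->
  (forall x, L <= v x) -> (\int[mu]_(x in D) (expR (v x))%:E <= 1)%E ->
  mu.-integrable D (EFin \o v).
Proof.
move=> mv Lv v1.
have := integrableD mD (integrable_expR mv v1) (integrable_cst_finite `|L|).
apply: le_integrable => //; first exact/measurable_EFinP/measurable_funTS.
move=> x Dx /=; rewrite lee_fin.
have e0 := expR_ge0 (v x); rewrite [leRHS]ger0_norm ?addr_ge0//.
have := Lv x; have := expR_ge1Dx (v x).
by case: (ger0P L); case: (ger0P (v x)); lra.
Qed.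

(** The series [S] of absolute increments has a finite integral, hence is finite almost everywhere.
    It makes the telescoping series converge and, added to the modulus of [v 0], dominates the whole
    sequence. *)
Lemma summable_increments_cvg (v : nat -> T -> R) (C : R) :
  (forall n, measurable_fun setT (v n)) ->
  mu.-integrable D (EFin \o v 0%N) ->
  (forall n, \int[mu]_(x in D) `|(v n.+1 x - v n x)%:E| <=
     (C * 2^-1 ^+ n)%:E)%E ->
  exists w h, [/\ measurable_fun setT w, mu.-integrable D h,
    {ae mu, forall x, D x -> v n x @[n --> \oo] --> w x} &
    {ae mu, forall x n, D x -> (`|(v n x)%:E| <= h x)%E}].
Proof.
move=> mv v0 vC.
have C0 : 0 <= C.
  rewrite -lee_fin; have := vC 0%N; rewrite expr0 mulr1.
  by apply: le_trans; exact: integral_ge0.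
pose dv n x := `|(v n.+1 x - v n x)%:E|%E.
pose S x := (\sum_(n <oo) dv n x)%E.
have dv0 n x : (0 <= dv n x)%E by exact: abse_ge0.
have mdv n : measurable_fun D (dv n).
  apply: measurableT_comp => //; apply/measurable_EFinP/measurable_funTS.
  exact: measurable_funB.
have iS : mu.-integrable D S.
  apply/integrableP; split.
    by apply: (@ge0_emeasurable_sum _ _ _ D dv xpredT) => // n x _ _; exact: abse_ge0.
  rewrite (eq_integral S); last first.
    by move=> x _; rewrite gee0_abs//; apply: nneseries_ge0.
  rewrite /S integral_nneseries//.
  apply: (@le_lt_trans _ _ (\sum_(n <oo) (C * 2^-1 ^+ n)%:E)%E).
    by apply: lee_nneseries => [n _ _|n _]; [exact: integral_ge0|exact: vC].
  have : series (fun n => C * 2^-1 ^+ n) @ \oo --> C * (1 - 2^-1)^-1.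
    by apply: cvg_geometric_series; rewrite ger0_norm; lra.
  move=> H; rewrite (_ : limn _ = (C * (1 - 2^-1)^-1)%:E) ?ltry//.
  apply/cvg_lim => //; apply: cvg_EFin.
    by apply: nearW => n; rewrite sumEFin.
  by apply: cvg_trans H; apply: near_eq_cvg; apply: nearW => n /=; rewrite sumEFin.
(* A limit superior is measurable without knowing where the sequence converges. *)
exists (fun x => fine (limn_esup (fun n => (v n x)%:E))).
exists (fun x => `|(v 0%N x)%:E| + S x)%E.
have inc x n : v n x = v 0%N x + series (fun k => v k.+1 x - v k x) n.
  by rewrite seriesEnat /= telescope_sumr// addrC subrK.
have dom x n : (`|(v n x)%:E| <= `|(v 0%N x)%:E| + S x)%E.
  rewrite inc EFinD (le_trans (lee_abs_add _ _))//.
  rewrite leeD2l// seriesEnat /=.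
  apply: (@le_trans _ _ (\sum_(0 <= k < n) dv k x)%E).
    by rewrite /dv /= sumEFin lee_fin ler_norm_sum.
  by apply: nneseries_lim_ge => // k _ _; exact: dv0.
split.
- apply: measurableT_comp => //; apply: measurable_fun_limn_esup => n.
  exact/measurable_EFinP.
- apply: integrableD => //; exact: integrable_abse.
- apply: filterS (integrable_ae mD iS) => x /[apply] Sx.
  have cv : cvgn (v ^~ x).
    rewrite (_ : v ^~ x = (cst (v 0%N x) \+
      series (fun k => v k.+1 x - v k x))); last first.
      by apply/funext => n /=; exact: inc.
    apply: is_cvgD; first exact: is_cvg_cst.
    apply: normed_cvg; apply: nondecreasing_is_cvgn.
      by apply: nondecreasing_series => i _ _; exact: normr_ge0.
    exists (fine (S x)) => _ [n _ <-]; rewrite -lee_fin fineK//.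
    apply: le_trans (@nneseries_lim_ge R (dv ^~ x) xpredT 0 n (fun k _ _ => dv0 k x)).
    by rewrite /dv sumEFin.
  have cvE : (fun n => (v n x)%:E) @ \oo --> (limn (v ^~ x))%:E.
    by apply: cvg_EFin; [exact: nearW|exact: cv].
  by rewrite is_cvg_limn_esupE ?(cvg_lim _ cvE)//; apply/cvg_ex; eexists; exact: cvE.
- by apply: aeW => x n _; exact: dom.
Qed.

End SummableIncrements.

(** * Strong convexity of the mass and its almost minimizers *)

Section StrongConvexity.
Context d (T : measurableType d) (R : realType).
Context (mu : {measure set T -> \bar R}) (D : set T).
Context (mD : measurable D) (muD : (mu D < +oo)%E).
Implicit Types (u v w : T -> R).

Lemma integrable_EFinZl (k : R) (f : T -> R) : mu.-integrable D (EFin \o f) ->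
  mu.-integrable D (EFin \o (fun x => k * f x)).
Proof. exact: integrableZl. Qed.

Lemma integrable_EFinD (f g : T -> R) : mu.-integrable D (EFin \o f) ->
  mu.-integrable D (EFin \o g) -> mu.-integrable D (EFin \o (fun x => f x + g x)).
Proof. exact: integrableD. Qed.

Lemma integrable_EFinB (f g : T -> R) : mu.-integrable D (EFin \o f) ->
  mu.-integrable D (EFin \o g) -> mu.-integrable D (EFin \o (fun x => f x - g x)).
Proof. exact: integrableB. Qed.

(** Logarithms of subprobability densities. The mass may drop below 1 so that the class is convex
    and closed under almost everywhere limits; the lower bound is pointwise, not almost
    everywhere. *)
Definition log_subdensity (L : R) v :=
  [/\ measurable_fun setT v, forall x, L <= v x &
      (\int[mu]_(x in D) (expR (v x))%:E <= 1)%E].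

Lemma log_subdensityW L L' v : L' <= L -> log_subdensity L v -> log_subdensity L' v.
Proof. by move=> LL' [? Lv ?]; split => // x; exact: le_trans (Lv x). Qed.

Definition midpoint u v x := (u x + v x) / 2.

Lemma log_subdensity_integrable L v : log_subdensity L v ->
  mu.-integrable D (EFin \o v).
Proof. by move=> [? ? ?]; exact: (@integrable_log_density _ _ _ _ _ mD muD L). Qed.

Lemma log_subdensity_integrable_expR L v : log_subdensity L v ->
  mu.-integrable D (EFin \o (fun x => expR (v x))).
Proof. by move=> [? ? ?]; exact: integrable_expR. Qed.

Let mass v := \int[mu]_(x in D) expR (v x).

Lemma expR_midpoint_le (p q : R) : expR ((p + q) / 2) <= (expR p + expR q) / 2.
Proof.
have [pq|/ltW qp] := leP p q.
  have := expR_strongly_convex (lexx p) pq.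
  have : 0 <= expR p / 4 * (p - q) ^+ 2 by rewrite mulr_ge0 ?sqr_ge0// divr_ge0 ?expR_ge0.
  lra.
have := expR_strongly_convex qp (lexx q).
have : 0 <= expR q / 4 * (p - q) ^+ 2 by rewrite mulr_ge0 ?sqr_ge0// divr_ge0 ?expR_ge0.
lra.
Qed.

Lemma log_subdensity_midpoint L u v : log_subdensity L u -> log_subdensity L v ->
  log_subdensity L (midpoint u v).
Proof.
move=> hu hv; have [mu_ Lu u1] := hu; have [mv Lv v1] := hv.
have mm : measurable_fun setT (midpoint u v).
  by apply: measurable_funM => //; exact: measurable_funD.
split => //; first by move=> x; have := Lu x; have := Lv x; rewrite /midpoint; lra.
have mE (f : T -> R) : measurable_fun setT f -> measurable_fun D (fun x => (expR (f x))%:E).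
  move=> mf; apply/measurable_EFinP; apply: measurableT_comp => //.
  exact: measurable_funTS.
have e0 (f : T -> R) x : D x -> (0 <= (expR (f x))%:E)%E by rewrite lee_fin expR_ge0.
apply: (@le_trans _ _ (\int[mu]_(x in D)
   (2^-1%:E * ((expR (u x))%:E + (expR (v x))%:E)))%E).
  apply: ge0_le_integral => //.
  - exact: mE.
  - by apply: emeasurable_funM => //; apply: emeasurable_funD; exact: mE.
  - move=> x Dx; rewrite -EFinD -EFinM lee_fin mulrC; exact: expR_midpoint_le.
rewrite ge0_integralZl_EFin//; last 2 first.
  - by move=> x Dx; rewrite adde_ge0 ?e0.
  - by apply: emeasurable_funD; exact: mE.
rewrite ge0_integralD//; do ?[exact: e0|exact: mE].
rewrite (_ : 1%E = (2^-1%:E * (1 + 1))%E); last first.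
  by rewrite -EFinD -EFinM; congr EFin; lra.
by rewrite lee_wpmul2l ?lee_fin ?invr_ge0//; exact: leeD.
Qed.

(* AM-GM turns the quadratic gap of [expR_strongly_convex] into an L1 bound. *)
Lemma L1_dist_le L eta u v : 0 < eta -> log_subdensity L u -> log_subdensity L v ->
  \int[mu]_(x in D) `|u x - v x| <=
  eta / 2 * fine (mu D) +
  2 / (eta * expR L) * (mass u + mass v - 2 * mass (midpoint u v)).
Proof.
move=> eta0 hu hv; have hm := log_subdensity_midpoint hu hv.
have [iu iv im] := And3 (log_subdensity_integrable_expR hu)
  (log_subdensity_integrable_expR hv) (log_subdensity_integrable_expR hm).
have iuv : mu.-integrable D (EFin \o (fun x => expR (u x) + expR (v x))).
  exact: integrable_EFinD.
have im2 : mu.-integrable D (EFin \o (fun x => 2 * expR (midpoint u v x))).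
  exact: integrable_EFinZl.
have ig : mu.-integrable D
    (EFin \o (fun x => expR (u x) + expR (v x) - 2 * expR (midpoint u v x))).
  exact: integrable_EFinB.
have igK : mu.-integrable D (EFin \o (fun x => 2 / (eta * expR L) *
    (expR (u x) + expR (v x) - 2 * expR (midpoint u v x)))).
  exact: integrable_EFinZl.
have ic := integrable_cst_finite mD muD (eta / 2).
rewrite /mass -RintegralZl// -RintegralD// -RintegralB//.
rewrite -RintegralZl// -Rintegral_cst// -RintegralD//.
apply: le_Rintegral => //.
- apply: integrable_norm; apply: integrable_EFinB.
    exact: log_subdensity_integrable hu.
  exact: log_subdensity_integrable hv.
- exact: integrable_EFinD.
- move=> x Dx; have [_ Lu _] := hu; have [_ Lv _] := hv.
  have := expR_strongly_convex (Lu x) (Lv x); rewrite -/(midpoint u v x).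
  set A := expR (u x) + _; set B := expR (midpoint _ _ _) => gap.
  have l0 := expR_gt0 L; have p0 : 0 < eta * expR L by rewrite mulr_gt0.
  (* The factor [2 / (eta * expR L)] is what turns the convexity gap [expR L / 4 * t ^+ 2] into the
     [t ^+ 2 / (2 * eta)] of AM-GM. *)
  have h : (u x - v x) ^+ 2 / (2 * eta) <= 2 / (eta * expR L) * (A - 2 * B).
    rewrite (_ : (u x - v x) ^+ 2 / (2 * eta) =
        2 / (eta * expR L) * (expR L / 4 * (u x - v x) ^+ 2)).
      by rewrite ler_wpM2l ?divr_ge0 ?(ltW p0)//; lra.
    by field; rewrite !gt_eqF.
  apply: le_trans (lerD (lexx _) h).
  rewrite -(@real_normK _ (u x - v x)) ?num_real//.
  set t := `| _ |; rewrite -subr_ge0.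
  rewrite (_ : _ - _ = (eta - t) ^+ 2 / (2 * eta)).
    by rewrite divr_ge0 ?sqr_ge0// mulr_ge0// ltW.
  by field; rewrite gt_eqF.
Qed.

(* Almost minimizers of the mass form an L1-Cauchy sequence, because the mass is
   strongly convex; this stands in for the weak compactness of the [C n]. *)
Lemma nested_midpoint_convex_cauchy (C : nat -> set (T -> R)) (L : R) :
  (forall n m, (n <= m)%N -> C m `<=` C n) -> (forall n, C n !=set0) ->
  (forall n v, C n v -> log_subdensity L v) ->
  (forall n u v, C n u -> C n v -> C n (midpoint u v)) ->
  exists (v : nat -> T -> R) (K : R), (forall n, C n (v n)) /\ forall n,
    (\int[mu]_(x in D) `|(v n.+1 x - v n x)%:E| <= (K * 2^-1 ^+ n)%:E)%E.
Proof.
move=> dC C0 CL Cm.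
(* The supremum [c] of [E] is the supremum over [n] of the infimum of the mass on [C n], here
   expressed through lower bounds. *)
pose E := [set t | exists n, forall v, C n v -> t <= mass v].
have E1 : ubound E 1.
  move=> t [n /(_ _)]; have [v Cv] := C0 n => /(_ _ Cv) /le_trans; apply.
  have [mv Lv v1] := CL _ _ Cv.
  rewrite -lee_fin fineK//; exact: integrable_fin_num (log_subdensity_integrable_expR (CL _ _ Cv)).
have Esup : has_sup E.
  split; last by exists 1.
  by exists 0; exists 0%N => v _; apply: Rintegral_ge0 => x _; exact: expR_ge0.
pose c := sup E; pose eta (i : nat) : R := 2^-1 ^+ i.
have eta0 i : 0 < eta i by rewrite exprn_gt0.
have lo i : exists n, forall v, C n v -> c - eta i ^+ 2 < mass v.
  have [t [n tn] ct] := sup_adherent (exprn_gt0 2 (eta0 i)) Esup.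
  by exists n => v /tn; exact: lt_le_trans.
have hi i n : exists2 v, C n v & mass v < c + eta i ^+ 2.
  apply: contrapT => H; have : c + eta i ^+ 2 <= c.
    apply: ub_le_sup; first by exists 1.
    exists n => v Cv; rewrite leNgt; apply/negP => vc; apply: H; by exists v.
  by rewrite gerDl leNgt exprn_gt0.
have [N Nlo] := choice lo.
(* Each [v i] lies deep enough for all masses at its level to exceed [c - eta i ^+ 2], while its own
   mass is below [c + eta i ^+ 2]. *)
have /choice[v vP] : forall i, exists v, C (maxn i (N i)) v /\ mass v < c + eta i ^+ 2.
  by move=> i; have [v Cv vc] := hi i (maxn i (N i)); exists v.
(* The excess [mass u + mass v - 2 * mass (midpoint u v)] will be at most [4 * eta i ^+ 2]; the L1
   bound taken with parameter [eta i] is then [eta i] times this constant. *)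
exists v, (2^-1 * fine (mu D) + 8 / expR L); split.
  by move=> n; have [+ _] := vP n; apply: dC; exact: leq_maxl.
move=> i.
have [Ci ci] := vP i; have [Cj cj] := vP i.+1.
(* [N] need not be monotone. The midpoint lies in the larger of the sets [C (N i)] and [C (N i.+1)],
   and either lower bound is good enough since [eta] decreases. *)
have mid : c - eta i ^+ 2 < mass (midpoint (v i.+1) (v i)).
  have [NN|/ltnW NN] := leqP (N i) (N i.+1).
    apply: Nlo; apply: Cm; [apply: dC Cj|apply: dC Ci]; last exact: leq_maxr.
    by rewrite (leq_trans NN)// leq_maxr.
  apply: (@le_lt_trans _ _ (c - eta i.+1 ^+ 2)).
    rewrite lerD2l lerN2 ler_sqr ?nnegrE ?(ltW (eta0 _))//.
    by rewrite /eta exprS ler_piMl// ?exprn_ge0//; lra.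
  apply: Nlo; apply: Cm; [apply: dC Cj|apply: dC Ci]; first exact: leq_maxr.
  by rewrite (leq_trans NN)// leq_maxr.
have LL := L1_dist_le (eta0 i) (CL _ _ Cj) (CL _ _ Ci).
have idist : mu.-integrable D (EFin \o (fun x => `|v i.+1 x - v i x|)).
  apply: integrable_norm; apply: integrable_EFinB.
    exact: log_subdensity_integrable (CL _ _ Cj).
  exact: log_subdensity_integrable (CL _ _ Ci).
rewrite -[leLHS]fineK ?lee_fin; last exact: integrable_fin_num idist.
apply: le_trans LL _; rewrite [leRHS]mulrDl; apply: lerD.
  by rewrite -/(eta i); lra.
have etaS : eta i.+1 ^+ 2 <= eta i ^+ 2.
  rewrite ler_sqr ?nnegrE ?(ltW (eta0 _))//.
  by rewrite /eta exprS ler_piMl// ?exprn_ge0//; lra.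
rewrite (_ : 8 / expR L * 2^-1 ^+ i = 2 / (eta i * expR L) * (4 * eta i ^+ 2)); last first.
  by rewrite -/(eta i); field; rewrite !gt_eqF ?expR_gt0.
rewrite ler_wpM2l ?divr_ge0 ?mulr_ge0 ?expR_ge0 ?(ltW (eta0 _))//; lra.
Qed.

End StrongConvexity.

(** * Uniform limits of smoothed log-subdensities are smoothed log-subdensities *)

Section ClosedUnderLimits.
Context d (T : measurableType d) (R : realType).
Context (mu : {measure set T -> \bar R}) (D : set T).
Context (mD : measurable D) (muD : (mu D < +oo)%E).

Lemma integrable_bounded_mul (k f : T -> R) (M : R) : measurable_fun D k ->
  (forall x, D x -> `|k x| <= M) -> mu.-integrable D (EFin \o f) ->
  mu.-integrable D (EFin \o (fun x => k x * f x)).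
Proof.
move=> mk kM intf; have mf : measurable_fun D f by apply/measurable_EFinP; exact: (measurable_int mu).
apply: le_integrable (integrable_EFinZl mD M intf) => //.
  by apply/measurable_EFinP; exact: measurable_funM.
move=> x Dx /=; rewrite lee_fin !normrM ler_wpM2r//.
exact: le_trans (kM x Dx) (ler_norm _).
Qed.

(** The distance to [phi x] is the modulus of an affine functional of [v], so the constraint
    survives midpoints; boundedness of [k] lets dominated convergence carry it to the limit. The
    slack in [alpha - eps] allows lower bounds that vary along the sequence. *)
Lemma log_subdensity_closed (X : Type) (k : X -> T -> R) (M : R) (phi : X -> R)
    (alpha : R) :
  (forall x, measurable_fun D (k x)) ->
  (forall x t, D t -> `|k x t| <= M) ->
  (forall eps : R, 0 < eps -> exists2 v, log_subdensity mu D (alpha - eps) v &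
     forall x, `|\int[mu]_(u in D) (k x u * v u) - phi x| <= eps) ->
  exists2 w, log_subdensity mu D alpha w &
    forall x, \int[mu]_(u in D) (k x u * w u) = phi x.
Proof.
move=> mk kM approx.
pose e (n : nat) : R := n.+1%:R^-1.
have e0 n : 0 < e n by rewrite invr_gt0.
have de n m : (n <= m)%N -> e m <= e n.
  by move=> nm; rewrite lef_pV2 ?posrE// ler_nat.
have e1 n : e n <= 1 by rewrite invf_le1// ler1n.
have ecvg : e n @[n --> \oo] --> 0 by exact: cvg_harmonic.
pose C n := [set v | log_subdensity mu D (alpha - e n) v /\
  forall x, `|\int[mu]_(u in D) (k x u * v u) - phi x| <= e n].
have ik x (v : T -> R) L : log_subdensity mu D L v ->
    mu.-integrable D (EFin \o (fun u => k x u * v u)).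
  move=> hv; apply: (@integrable_bounded_mul _ _ M) => //; first exact: kM.
  exact: (log_subdensity_integrable mD muD hv).
have dC n m : (n <= m)%N -> C m `<=` C n.
  move=> nm v [hv vphi]; split; last by move=> x; exact: le_trans (vphi x) (de _ _ nm).
  by apply: log_subdensityW hv; have := de _ _ nm; lra.
have C0 n : C n !=set0 by have [v ? ?] := approx _ (e0 n); exists v.
have CL n v : C n v -> log_subdensity mu D (alpha - 1) v.
  by move=> [+ _]; apply: log_subdensityW; have := e1 n; lra.
have Cm n u v : C n u -> C n v -> C n (midpoint u v).
  move=> [hu uphi] [hv vphi]; split; first exact: log_subdensity_midpoint.
  move=> x; rewrite (_ : \int[mu]_(t in D) _ =
     2^-1 * (\int[mu]_(t in D) (k x t * u t) + \int[mu]_(t in D) (k x t * v t))).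
    have := uphi x; have := vphi x; rewrite !ler_norml; lra.
  rewrite -RintegralD//; [|exact: ik hu|exact: ik hv].
  rewrite -RintegralZl//; last by apply: integrable_EFinD => //; [exact: ik hu|exact: ik hv].
  by apply: eq_Rintegral => t _; rewrite /midpoint; lra.
have [v [K [Cv vK]]] := nested_midpoint_convex_cauchy mD muD dC C0 CL Cm.
have mv n : measurable_fun setT (v n) by have [] := CL _ _ (Cv n).
have [w0 [h [mw0 ih vw0 vh]]] := summable_increments_cvg mD mv
  (log_subdensity_integrable mD muD (CL _ _ (Cv 0%N))) vK.
(* The limit is at least [alpha] only almost everywhere; the maximum enforces it at every point and
   changes [w0] on a null set within [D]. *)
pose w x := Num.max alpha (w0 x).
have mw : measurable_fun setT w by exact: measurable_maxr.
have vw : {ae mu, forall x, D x -> v n x @[n --> \oo] --> w x}.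
  apply: filterS vw0 => x /[apply] vx; rewrite /w max_r//.
  have : (alpha - e n) @[n --> \oo] --> alpha - 0 by apply: cvgB => //; exact: cvg_cst.
  rewrite subr0 => ae_; apply: ler_cvg_to ae_ vx _; apply: nearW => n.
  by have [[_ + _] _] := Cv n; exact.
have mE (f : T -> R) : measurable_fun setT f -> measurable_fun D (fun x => (expR (f x))%:E).
  move=> mf; apply/measurable_EFinP; apply: measurableT_comp => //.
  exact: measurable_funTS.
(* Rewritten as a limit inferior, the mass of the limit is in the form that Fatou bounds by the
   masses of the [v n]. *)
have ewE : (\int[mu]_(x in D) (expR (w x))%:E =
    \int[mu]_(x in D) limn_einf (fun n => (expR (v n x))%:E))%E.
  apply: ge0_ae_eq_integral => //.
  - exact: mE.
  - rewrite /limn_einf; apply: measurableT_comp => //.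
    apply: (@measurable_fun_limn_esup _ _ _ _ (fun n x => (- (expR (v n x))%:E)%E)) => n.
    by apply: measurableT_comp => //; exact: mE.
  - move=> x _; rewrite limn_einf_lim; apply: lime_ge; first exact: is_cvg_einfs.
    by apply: nearW => n; apply: le_ereal_inf_tmp => _ [m _ <-]; rewrite lee_fin expR_ge0.
  - apply: filterS vw => x /[apply] vx.
    have H : (expR (v n x))%:E @[n --> \oo] --> (expR (w x))%:E.
      apply: cvg_EFin; first exact: nearW.
      by apply: continuous_cvg vx; exact: continuous_expR.
    by have [-> _] := cvg_limn_einf_sup H.
exists w.
  split => //; first by move=> x; rewrite /w le_max lexx.
  have F : (\int[mu]_(x in D) limn_einf (fun n => (expR (v n x))%:E) <=
      limn_einf (fun n => \int[mu]_(x in D) (expR (v n x))%:E))%E.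
    by apply: fatou => // n; exact: mE.
  rewrite ewE (le_trans F)//.
  rewrite limn_einf_lim; apply: lime_le; first exact: is_cvg_einfs.
  apply: nearW => n; apply: ge_ereal_inf.
  exists (\int[mu]_(x in D) (expR (v n x))%:E)%E; first by exists n => /=.
  by have [] := CL _ _ (Cv n).
move=> x.
have iw : mu.-integrable D (EFin \o w) /\
    (\int[mu]_(u in D) (k x u * v n u)%:E)%E @[n --> \oo] -->
    (\int[mu]_(u in D) (k x u * w u)%:E)%E.
  split.
    have [] // := @dominated_convergence _ _ _ mu _ mD (fun n => EFin \o v n) (EFin \o w) h.
    - by move=> n; exact/measurable_EFinP/measurable_funTS.
    - exact/measurable_EFinP/measurable_funTS.
    - apply: filterS vw => t /[apply] vt; apply: cvg_EFin => //; exact: nearW.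
  have [] // := @dominated_convergence _ _ _ mu _ mD
    (fun n => EFin \o (fun u => k x u * v n u)) (EFin \o (fun u => k x u * w u))
    (fun u => `|M|%:E * h u)%E.
  - by move=> n; apply/measurable_EFinP; apply: measurable_funM => //; exact: measurable_funTS.
  - by apply/measurable_EFinP; apply: measurable_funM => //; exact: measurable_funTS.
  - apply: filterS vw => t /[apply] vt; apply: cvg_EFin; first exact: nearW.
    exact: cvgZr.
  - exact: integrableZl.
  - apply: filterS vh => t + n Dt => /(_ n Dt) vht.
    rewrite /= normrM EFinM lee_pmul// ?lee_fin//.
    exact: le_trans (kM x t Dt) (ler_norm _).
have [iw' cw] := iw.
have ikw := integrable_bounded_mul (mk x) (kM x) iw'.
have cw' : \int[mu]_(u in D) (k x u * v n u) @[n --> \oo] --> \int[mu]_(u in D) (k x u * w u).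
  apply: fine_cvg; rewrite fineK//; exact: integrable_fin_num ikw.
have cphi : \int[mu]_(u in D) (k x u * v n u) @[n --> \oo] --> phi x.
  apply/cvgrPdist_le => eps eps0.
  have /cvgrPdist_le /(_ _ eps0) := ecvg; apply: filterS => n.
  rewrite sub0r normrN gtr0_norm// distrC => le_e.
  by have [_ /(_ x) H] := Cv n; exact: le_trans H le_e.
exact: (cvg_unique _ cw' cphi).
Qed.

End ClosedUnderLimits.

(** * Compactness: cluster points of bounded and of equi-Lipschitz sequences *)

Lemma bounded_pointwise_cluster (I : eqType) (R : realType) (u : nat -> I -> R)
    (K : R) : (forall n i, `|u n i| <= K) ->
  exists p : I -> R, forall (t : seq I) (eps : R) N, 0 < eps ->
    exists2 n, (N <= n)%N & forall i, i \in t -> `|u n i - p i| < eps.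
Proof.
move=> uK.
(* An uncountable power of a segment is compact but not sequentially compact, so the result is a
   cluster point, approached on each finite set of indices, and not the limit of a subsequence. *)
have cptA := @tychonoff I (fun _ => R) (fun _ => `[- K, K]%classic)
  (fun _ => @segment_compact R (- K) K).
have FA : (u n @[n --> \oo]) [set f : I -> R | forall i, `[- K, K]%classic (f i)].
  by exists 0%N => // n _ i /=; rewrite in_itv /= -ler_norml.
have [p [_ clp]] := cptA _ _ FA.
exists p => t eps N eps0.
pose X : topologicalType := prod_topology (fun _ : I => R).
pose P (t' : seq I) : set X := [set f : X | forall i, i \in t' -> `|f i - p i| < eps].
have near_p : nbhs (p : X) (P t).
  elim: t => [|i t IH].
    have -> : P [::] = setT by apply/seteqP; split => // f _ i.
    exact: filterT.
  have near_i : nbhs (p : X) [set f : X | `|f i - p i| < eps].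
    apply: (@proj_continuous I (fun=> R) i p [set y | `|y - p i| < eps]).
    apply/nbhs_ballP; exists eps => //= y.
    by rewrite /ball /= distrC.
  apply: (@filterS _ _ (nbhs_filter (p : X)) _ _ _ (filterI near_i IH)) => f [fi ft] j.
  by rewrite in_cons => /orP[/eqP ->|jt]; [exact: fi|exact: ft].
have FN : (u n @[n --> \oo]) [set u n | n in [set n | (N <= n)%N]].
  by exists N => // n Nn; exists n.
have [f [[n Nn <-] fp]] := clp _ _ FN near_p.
by exists n.
Qed.

(** The net is made of the centres of [N] equal cells, which keeps it away from the endpoints. *)
Lemma itv_finite_net (R : realType) (a b delta : R) : a < b -> 0 < delta ->
  exists2 t : seq R, {in t, forall y, y \in `]a, b[} &
    forall x, x \in `]a, b[ -> exists2 y, y \in t & `|x - y| <= delta.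
Proof.
move=> ab d0.
have [N N0 bN] : exists2 N : nat, 0 < N%:R :> R & b - a < delta * N%:R.
  exists (Num.trunc ((b - a) / delta)).+1; first by rewrite ltr0n.
  by rewrite mulrC -ltr_pdivrMr// truncnS_gt.
pose h := (b - a) / N%:R.
have h0 : 0 < h by rewrite divr_gt0// subr_gt0.
have hd : h <= delta by rewrite ler_pdivrMr// ltW.
have hN : h * N%:R = b - a by rewrite divfK// gt_eqF.
exists [seq a + (i%:R + 2^-1) * h | i <- iota 0 N].
  move=> y /mapP[i]; rewrite mem_iota add0n => /andP[_ iN] ->.
  have i0 : 0 <= i%:R :> R by [].
  have iN' : i%:R + 1 <= N%:R :> R by rewrite natr1 ler_nat.
  by rewrite in_itv /=; apply/andP; split; nra.
move=> x; rewrite in_itv /= => /andP[ax xb].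
have xh0 : 0 <= (x - a) / h by rewrite divr_ge0 ?ltW// subr_gt0.
set i := Num.trunc ((x - a) / h).
have /andP[ix xi] := truncn_itv xh0; rewrite -/i in ix xi.
rewrite ler_pdivlMr// in ix; rewrite ltr_pdivrMr// in xi.
exists (a + (i%:R + 2^-1) * h).
  apply: (map_f (fun i : nat => a + (i%:R + 2^-1) * h)); rewrite mem_iota add0n leq0n /=.
  by rewrite truncn_lt_nat// ltr_pdivrMr// mulrC hN; lra.
by rewrite -natr1 in xi; rewrite ler_norml; apply/andP; split; nra.
Qed.

(** Arzela-Ascoli phrased with cluster points: the pointwise cluster function inherits the modulus
    of continuity, so closeness on a finite net, for all [j] in the finite index type at once,
    spreads to the whole interval. *)
Lemma equilipschitz_uniform_cluster (J : finType) (R : realType) (a b : R)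
    (f : nat -> J -> R -> R) (K Lam : R) : a < b ->
  (forall n j x, x \in `]a, b[ -> `|f n j x| <= K) ->
  (forall n j, {in `]a, b[ &, forall x y, `|f n j x - f n j y| <= Lam * `|x - y|}) ->
  exists phi : J -> R -> R, forall (eps : R) N, 0 < eps -> exists2 n, (N <= n)%N &
    forall j x, x \in `]a, b[ -> `|f n j x - phi j x| <= eps.
Proof.
move=> ab fK fLam.
(* Extension by 0 makes the family bounded at every real, as Tychonoff requires. *)
pose u n (i : J * R) := if i.2 \in `]a, b[ then f n i.1 i.2 else 0.
have [|p pP] := @bounded_pointwise_cluster _ _ u `|K|.
  move=> n [j x]; rewrite /u /=; case: ifPn => [xab|_]; last by rewrite normr0.
  exact: le_trans (fK _ _ _ xab) (ler_norm _).
exists (fun j x => p (j, x)) => eps N eps0.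
have e8 : 0 < eps / 8 by rewrite divr_gt0.
have L0 : 0 < `|Lam| + 1 by rewrite ltr_wpDl.
pose delta := eps / 4 / (`|Lam| + 1).
have d0 : 0 < delta by rewrite !divr_gt0.
have Ld (x y : R) : `|x - y| <= delta -> Lam * `|x - y| <= eps / 4.
  move=> xyd; have -> : eps / 4 = (`|Lam| + 1) * delta by rewrite /delta [RHS]mulrC divfK ?gt_eqF.
  have : Lam <= `|Lam| + 1 by have := ler_norm Lam; lra.
  move=> LL; have := normr_ge0 (x - y); nra.
(* The cluster function is compared with one [f n] at both points: [eps / 8 + eps / 4 + eps / 8]. *)
have pLip j x y : x \in `]a, b[ -> y \in `]a, b[ -> `|x - y| <= delta ->
    `|p (j, x) - p (j, y)| <= eps / 2.
  move=> xab yab xyd.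
  have [n _ H] := pP [:: (j, x); (j, y)] (eps / 8) 0%N e8.
  have := H (j, x); have := H (j, y); rewrite !inE !eqxx orbT => /(_ isT) + /(_ isT).
  rewrite /u /= xab yab; have := le_trans (fLam n j _ _ xab yab) (Ld x y xyd).
  rewrite !ltr_norml !ler_norml; lra.
have [t tab tnet] := itv_finite_net ab d0.
have [n Nn nP] := pP [seq (j, y) | j <- enum J, y <- t] (eps / 8) N e8.
exists n => // j x xab.
have [y yt xyd] := tnet x xab; have yab := tab _ yt.
have : `|u n (j, y) - p (j, y)| < eps / 8.
  by apply: nP; apply: allpairs_f => //; rewrite mem_enum.
(* The error budget is [eps / 4] to move [f n] from [x] to the net point [y], [eps / 8] at [y], and
   [eps / 2] to move the cluster function back. *)
rewrite /u /= yab; have := pLip j _ _ xab yab xyd.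
have := le_trans (fLam n j _ _ xab yab) (Ld x y xyd).
rewrite !ltr_norml !ler_norml; lra.
Qed.

(** * Integrals of products of one-variable functions *)

Section ProductIntegral.
Context {R : realType}.
Notation lambda := (@lebesgue_measure R).

Lemma L1_measurable (f : R -> R) : L1 f ->
  measurable_fun [set: measurableTypeR R] (f : measurableTypeR R -> measurableTypeR R).
Proof. by move=> f1; apply/measurable_EFinP; exact: (measurable_int lambda). Qed.

Lemma measurable_prod_tnth n (F : 'I_n -> R -> R) :
  (forall i, measurable_fun [set: measurableTypeR R] (F i : measurableTypeR R -> measurableTypeR R)) ->
  measurable_fun [set: pt R n] (fun x : pt R n => \prod_(i < n) F i (tnth x i)).
Proof.
move=> mF; apply: measurable_prod => i _.
exact: measurableT_comp (mF i) (measurable_tnth i).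
Qed.

(** Induction peeling off the first coordinate, starting from the Dirac mass at the empty tuple:
    Tonelli on absolute values gives integrability, then Fubini the value. *)
Lemma integral_leb_prod n (F : 'I_n -> R -> R) : (forall i, L1 (F i)) ->
  (leb n).-integrable [set: pt R n] (fun x => (\prod_(i < n) F i (tnth x i))%:E) /\
  (\int[leb n]_x (\prod_(i < n) F i (tnth x i))%:E =
   (\prod_(i < n) \int[lambda]_t F i t)%:E)%E.
Proof.
elim: n F => [|n IH] F F1.
  have mF := @measurable_prod_tnth 0 F (fun i => L1_measurable (F1 i)).
  split.
    apply/integrableP; split; first exact/measurable_EFinP.
    rewrite /= integral_dirac//; last first.
      by apply/measurable_EFinP; apply: measurableT_comp.
    by rewrite diracT mul1e ltry.
  rewrite /= integral_dirac//; last exact/measurable_EFinP.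
  by rewrite diracT mul1e !big_ord0.
have mF := @measurable_prod_tnth n.+1 F (fun i => L1_measurable (F1 i)).
have [iG eG] := IH (fun i => F (lift ord0 i)) (fun i => F1 (lift ord0 i)).
set G := (fun x : pt R n => \prod_(i < n) F (lift ord0 i) (tnth x i)) in iG eG.
pose f (p : measurableTypeR R * pt R n) : \bar R := (F ord0 p.1 * G p.2)%:E.
have fE p : (\prod_(i < n.+1) F i (tnth (consp p) i))%:E = f p.
  by rewrite big_ord_recl /f; congr ((_ * _)%:E); apply: eq_bigr => i _; rewrite tnthS.
have mG : measurable_fun setT G by exact: measurable_prod_tnth (fun i => L1_measurable (F1 _)).
have mf : measurable_fun setT f.
  apply/measurable_EFinP; apply: measurable_funM.
    exact: measurableT_comp (L1_measurable (F1 ord0)) measurable_fst.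
  exact: measurableT_comp mG measurable_snd.
have i0 := F1 ord0.
have if_ : (lambda \x leb n)%E.-integrable setT f.
  apply/integrable12ltyP => //.
  rewrite (_ : (fun _ => _) = (fun x => `|F ord0 x|%:E * \int[leb n]_y `|G y|%:E)%E); last first.
    apply/funext => x; rewrite /f /=.
    rewrite -ge0_integralZl_EFin//; last first.
      by apply/measurable_EFinP; apply: measurableT_comp.
    by apply: eq_integral => y _; rewrite normrM EFinM.
  have /fineK <- : (\int[leb n]_y `|G y|%:E)%E \is a fin_num.
    exact: integrable_fin_num (integrable_abse iG).
  have := integrableZr measurableT (fine (\int[leb n]_y `|G y|%:E)%E) (integrable_abse i0).
  move=> H; have := integrable_lty _ H; exact.
have ig : (lambda \x leb n)%E.-integrable (@consp R n @^-1` setT)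
    ((fun x => (\prod_(i < n.+1) F i (tnth x i))%:E) \o @consp R n).
  by rewrite preimage_setT; apply: eq_integrable if_ => // p _; rewrite /= fE.
split.
  apply: integrable_pushforward => //; first exact: measurable_consp.
  exact/measurable_EFinP.
rewrite /= integral_pushforward//; last 2 first.
- exact: measurable_consp.
- exact/measurable_EFinP.
rewrite preimage_setT (eq_integral f); last by move=> p _; rewrite /= fE.
rewrite -integral12_prod_meas1// big_ord_recl EFinM.
rewrite (_ : (fun _ => _) = (fun x => (F ord0 x)%:E * (\prod_(i < n) \int[lambda]_t F (lift ord0 i) t)%:E)%E).
  rewrite integralZr//; congr (_ * _)%E.
  by rewrite fineK//; exact: integrable_fin_num i0.
by apply/funext => x; rewrite -eG -integralZl.
Qed.

End ProductIntegral.

(** * One-variable smoothing: bounds and Lipschitz continuity *)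

Section Kernel.
Context (R : realType) (a b : R).
Notation lambda := (@lebesgue_measure R).
Notation J := (`]a, b[%classic).

Lemma lebesgue_itv_lty : (lambda J < +oo)%E.
Proof. by rewrite lebesgue_measure_itv /=; case: ifP => // _; rewrite -EFinB ltry. Qed.

(** The two endpoints are null; this moves integrals to the open interval, where the kernel is
    Lipschitz. *)
Lemma integral_support_itv (f : R -> R) :
  measurable_fun [set: measurableTypeR R] (f : measurableTypeR R -> measurableTypeR R) ->
  (forall t, t \notin `[a, b] -> f t = 0) ->
  (\int[lambda]_t (f t)%:E = \int[lambda]_(t in J) (f t)%:E)%E.
Proof.
move=> mf f0.
transitivity (\int[lambda]_(t in `[a, b]%classic) (f t)%:E)%E.
  rewrite [RHS]integral_mkcond; apply: eq_integral => t _.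
  rewrite /restrict; case: ifPn => // /negP tab; rewrite f0//.
  by apply/negP => tin; apply: tab; rewrite inE /=.
by rewrite integral_itv_bndoo//; exact/measurable_EFinP/measurable_funTS.
Qed.

Lemma L1_support_itv (f : R -> R) :
  measurable_fun [set: measurableTypeR R] (f : measurableTypeR R -> measurableTypeR R) ->
  (forall t, t \notin `[a, b] -> f t = 0) ->
  lambda.-integrable J (EFin \o f) -> L1 f.
Proof.
move=> mf f0 /integrableP[_ fJ]; apply/integrableP; split; first exact/measurable_EFinP.
have := @integral_support_itv (fun t => `|f t|); rewrite /= => -> //.
- exact: measurableT_comp.
- by move=> t tab; rewrite f0// normr0.
Qed.

Let mJ : measurable (J : set (measurableTypeR R)) := measurable_itv _.
Let lJ := lebesgue_itv_lty.

Context (M1 M2 B : R) (s : R -> R -> R) (ab : a < b).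
Context (hs : smoothing_kernel a b M1 M2 B s).

Lemma mem_itvoo_cc (x : R) : x \in `]a, b[ -> x \in `[a, b].
Proof. by rewrite !in_itv /= => /andP[/ltW -> /ltW ->]. Qed.

Lemma kernel_measurable x :
  measurable_fun [set: measurableTypeR R] ((s ^~ x) : measurableTypeR R -> measurableTypeR R).
Proof.
have mS : measurable_fun [set: measurableTypeR R * measurableTypeR R]
    (fun p => s p.1 p.2 : measurableTypeR R).
  by apply/measurable_EFinP; exact: measurable_int (sk_L1 hs).
have mp : measurable_fun [set: measurableTypeR R]
    (fun u : measurableTypeR R => (u, x : measurableTypeR R)).
  by apply: measurable_fun_pair.
exact: (measurableT_comp mS mp).
Qed.

Lemma kernel_out u x : u \notin `[a, b] -> s u x = 0.
Proof. by move=> /negbTE uab; rewrite (sk_support hs)// uab. Qed.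

Lemma kernel_norm_le u x : x \in `[a, b] -> `|s u x| <= M2.
Proof.
move=> xab; have [uab|uab] := boolP (u \in `[a, b]).
  by have /andP[_] := sk_bounds hs uab xab; rewrite ger0_norm// (sk_ge0 hs).
by rewrite kernel_out// normr0 ltW// (sk_M2 hs).
Qed.

Lemma integrable_kernel_mul x (w : R -> R) : x \in `[a, b] ->
  lambda.-integrable J (EFin \o w) ->
  lambda.-integrable J (EFin \o (fun u => s u x * w u)).
Proof.
move=> xab iw; apply: (@integrable_bounded_mul _ _ _ _ _ _ _ _ M2) => //.
  exact: measurable_funTS (kernel_measurable x).
by move=> u _; exact: kernel_norm_le.
Qed.

Lemma integrable_kernel x : x \in `[a, b] -> lambda.-integrable J (EFin \o (s ^~ x)).
Proof.
move=> xab; have := integrable_kernel_mul xab (integrable_cst_finite mJ lJ 1).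
by apply: eq_integrable => // u _ /=; rewrite mulr1.
Qed.

Lemma integral_kernel x : x \in `[a, b] -> \int[lambda]_(u in J) s u x = 1.
Proof.
move=> xab; rewrite /Rintegral -integral_support_itv ?(sk_int1 hs xab)//.
  exact: kernel_measurable.
by move=> u uab; exact: kernel_out.
Qed.

Definition smooth (w : R -> R) x := \int[lambda]_(u in J) (s u x * w u).

(** The section [s ^~ x] is a probability density, so smoothing averages [w]. *)
Lemma smooth_ge (alpha : R) w x : x \in `[a, b] ->
  log_subdensity lambda J alpha w -> alpha <= smooth w x.
Proof.
move=> xab hw; have iw := log_subdensity_integrable mJ lJ hw; have [_ wa _] := hw.
have -> : alpha = \int[lambda]_(u in J) (s u x * alpha).
  by rewrite RintegralZr ?integral_kernel ?mul1r//; exact: integrable_kernel.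
apply: le_Rintegral => //.
- exact: (integrable_kernel_mul xab (integrable_cst_finite mJ lJ alpha)).
- exact: integrable_kernel_mul.
- by move=> u _; rewrite ler_wpM2l// (sk_ge0 hs).
Qed.

(** Combines [w <= expR w], [s <= M2] and mass at most 1; no upper bound on [w] itself is
    available. *)
Lemma smooth_le (alpha : R) w x : x \in `[a, b] ->
  log_subdensity lambda J alpha w -> smooth w x <= M2.
Proof.
move=> xab hw; have iw := log_subdensity_integrable mJ lJ hw; have [_ _ w1] := hw.
have ie := log_subdensity_integrable_expR hw.
have m0 : 0 <= M2 by rewrite ltW// (sk_M2 hs).
apply: (@le_trans _ _ (\int[lambda]_(u in J) (M2 * expR (w u)))).
  apply: le_Rintegral => //; first exact: integrable_kernel_mul.
    exact: integrable_EFinZl.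
  move=> u _; have := sk_ge0 hs u x; have := kernel_norm_le u xab.
  have := expR_ge1Dx (w u); have := expR_gt0 (w u).
  move=> e0 e1 /ler_normlW sM s0.
  apply: (@le_trans _ _ (s u x * expR (w u))); first by rewrite ler_wpM2l//; lra.
  by rewrite ler_wpM2r// ltW.
rewrite RintegralZl// ler_piMr// -lee_fin fineK//.
exact: integrable_fin_num ie.
Qed.

(** Mean value theorem in the second argument, with the bound [B] on the partial derivative. *)
Lemma kernel_lipschitz u x y : u \in `]a, b[ -> x \in `]a, b[ -> y \in `]a, b[ ->
  `|s u x - s u y| <= B * `|x - y|.
Proof.
move=> uab; wlog xy : x y / x <= y.
  move=> H xab yab; have [xy|/ltW yx] := leP x y; first exact: H.
  by rewrite distrC (distrC x) H.
move=> xab yab.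
have sub t : t \in `[x, y] -> t \in `]a, b[.
  move: xab yab; rewrite !in_itv /= => /andP[ax _] /andP[_ yb] /andP[xt ty].
  by rewrite (lt_le_trans ax)//= (le_lt_trans ty).
have der t : t \in `[x, y] -> derivable (fun z => s u z) t 1.
  by move=> /sub tab; have [] := sk_derivable hs uab tab.
have [||c cxy E] := @MVT_segment _ (fun z => s u z) (derive1 (fun z => s u z)) x y xy.
- by move=> t txy; rewrite derive1E; apply: derivableP; apply: der; exact: subset_itv_oo_cc txy.
- by apply: derivable_within_continuous => t; exact: der.
rewrite distrC E normrM distrC ler_wpM2r//.
by have [_] := sk_C1_bound hs uab (sub _ cxy).
Qed.

Lemma norm_log_subdensity_le (alpha : R) w : log_subdensity lambda J alpha w ->
  \int[lambda]_(u in J) `|w u| <= 1 + `|alpha| * (b - a).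
Proof.
move=> hw; have iw := log_subdensity_integrable mJ lJ hw; have [_ wa w1] := hw.
have ie := log_subdensity_integrable_expR hw.
have ic := integrable_cst_finite mJ lJ `|alpha|.
apply: (@le_trans _ _ (\int[lambda]_(u in J) (expR (w u) + `|alpha|))).
  apply: le_Rintegral => //; first exact: integrable_norm.
    exact: integrable_EFinD.
  move=> u _; have := wa u; have := expR_ge1Dx (w u); have := expR_gt0 (w u).
  by case: (ger0P (w u)); case: (ger0P alpha); lra.
rewrite RintegralD// Rintegral_cst// [X in _ * X](_ : _ = b - a); last first.
  have lJE : fine (lambda J) = b - a by rewrite lebesgue_measure_itv /= lte_fin ab.
  exact: lJE.
rewrite lerD2r.
by rewrite -lee_fin fineK//; exact: integrable_fin_num ie.
Qed.

(** The constant is [B] times a bound on the L1 norm of [w]; it depends on [w] only through [alpha],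
    which makes the smoothings equi-Lipschitz once the [alpha] are bounded. *)
Lemma smooth_lipschitz (alpha : R) w x y : x \in `]a, b[ -> y \in `]a, b[ ->
  log_subdensity lambda J alpha w ->
  `|smooth w x - smooth w y| <= B * (1 + `|alpha| * (b - a)) * `|x - y|.
Proof.
move=> xab yab hw; have iw := log_subdensity_integrable mJ lJ hw.
have ix := integrable_kernel_mul (mem_itvoo_cc xab) iw.
have iy := integrable_kernel_mul (mem_itvoo_cc yab) iw.
have B0 : 0 <= B by have [+ _] := sk_C1_bound hs xab yab; exact: le_trans.
rewrite /smooth -RintegralB//; apply: le_trans (le_normr_Rintegral _ _) _ => //.
  exact: integrable_EFinB.
apply: (@le_trans _ _ (\int[lambda]_(u in J) (B * `|x - y| * `|w u|))).
  apply: le_Rintegral => //.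
  - by apply: integrable_norm => //; exact: integrable_EFinB.
  - by apply: integrable_EFinZl => //; exact: integrable_norm.
  - by move=> u uab; rewrite -mulrBl normrM ler_wpM2r//; exact: kernel_lipschitz.
rewrite RintegralZl//; last exact: integrable_norm.
rewrite mulrAC ler_wpM2r// ler_wpM2l//; exact: norm_log_subdensity_le hw.
Qed.

Lemma measurable_smooth (alpha : R) w : log_subdensity lambda J alpha w ->
  measurable_fun (J : set (measurableTypeR R)) (smooth w : measurableTypeR R -> measurableTypeR R).
Proof.
move=> hw; apply: open_continuous_measurable_fun; first exact: interval_open.
move=> x; rewrite inE => xab.
set Lam := B * (1 + `|alpha| * (b - a)).
apply/cvgrPdist_le => eps eps0.
have L0 : 0 < `|Lam| + 1 by rewrite ltr_wpDl.
near=> y.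
have yab : y \in `]a, b[ by near: y; exact: near_in_itvoo.
apply: le_trans (smooth_lipschitz xab yab hw) _; rewrite -/Lam.
apply: (@le_trans _ _ ((`|Lam| + 1) * `|x - y|)).
  by rewrite ler_wpM2r//; have := ler_norm Lam; lra.
rewrite mulrC -ler_pdivlMr//.
near: y; apply/nbhs_ballP; exists (eps / (`|Lam| + 1)) => /=; first exact: divr_gt0.
by move=> y; rewrite /ball /= => /ltW.
Unshelve. all: by end_near.
Qed.

End Kernel.

Lemma expR_ln (R : realType) (x : R) : 0 < x -> expR (ln x) = x.
Proof. by move=> x0; exact: lnK. Qed.

(** Since [y >= delta], one has [y + q <= y * (1 + q / delta) <= y * expR (q / delta)]. *)
Lemma ln_le_perturb (R : realType) (x y q delta t : R) : 0 < x -> 0 < delta ->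
  delta <= y -> 0 <= q -> x <= expR t * (y + q) -> ln x <= ln y + (t + q / delta).
Proof.
move=> x0 d0 dy q0 xy; have y0 := lt_le_trans d0 dy.
rewrite -ler_expR expRD (expR_ln x0) (expR_ln y0) expRD; apply: le_trans xy _.
rewrite [leRHS]mulrCA ler_wpM2l ?expR_ge0//.
have -> : y + q = y * (1 + q / y) by rewrite mulrDr mulr1 [y * (q / y)]mulrC divfK ?gt_eqF.
rewrite ler_wpM2l ?(ltW y0)//; apply: le_trans (expR_ge1Dx _); rewrite lerD2l.
by rewrite ler_wpM2l// lef_pV2 ?posrE.
Qed.

Lemma norm_ln_le (R : realType) (x lo hi : R) : expR lo <= x <= expR hi ->
  `|ln x| <= `|lo| + `|hi|.
Proof.
move=> /andP[lx xh]; have x0 : 0 < x by exact: lt_le_trans (expR_gt0 _) lx.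
move: lx xh; rewrite -(expR_ln x0) !ler_expR expRK => lo_ hi_; rewrite ler_norml.
by case: (ger0P lo); case: (ger0P hi); lra.
Qed.

(** * Normalised mixtures: uniform bounds and stability *)

Section Mixture.
Context (R : realType) (r m : nat) (a b M1 M2 B : R) (s : R -> R -> R).
Context (ab : a < b) (hs : smoothing_kernel a b M1 M2 B s).
Notation lambda := (@lebesgue_measure R).
Notation J := (`]a, b[%classic).

Definition obox : set (pt R r) := [set x | forall k, tnth x k \in `]a, b[].

(** All constraints are non-strict, so that they pass to limits: weights may vanish, densities may
    lose mass, and only the sum over [k] of the lower bounds is prescribed. *)
Definition mixture_data (c : 'I_m -> R) (al : 'I_m -> 'I_r -> R)
    (w : 'I_m -> 'I_r -> R -> R) :=
  [/\ forall j, 0 <= c j, \sum_(j < m) c j = 1,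
      forall j, ln M1 *+ r <= \sum_(k < r) al j k &
      forall j k, log_subdensity lambda J (al j k) (w j k)].

Definition mixture (c : 'I_m -> R) (w : 'I_m -> 'I_r -> R -> R) (x : pt R r) :=
  \sum_(j < m) c j * expR (\sum_(k < r) smooth a b s (w j k) (tnth x k)).

Let L := ln M1 *+ r - (b - a)^-1 *+ r.

(** Integrating the lower bound gives [expR alpha * (b - a) <= 1], and [1 + alpha <= expR alpha]. *)
Lemma log_subdensity_lower_le (alpha : R) w : log_subdensity lambda J alpha w ->
  alpha <= (b - a)^-1.
Proof.
move=> hw; have [_ wa w1] := hw.
have ba : 0 < b - a by rewrite subr_gt0.
have le1 : expR alpha * (b - a) <= 1.
  rewrite -lee_fin; apply: le_trans w1.
  have -> : (expR alpha * (b - a))%:E = (\int[lambda]_(x in J) (cst (expR alpha)%:E) x)%E.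
    by rewrite integral_cst//= lebesgue_measure_itv /= lte_fin ab.
  apply: ge0_le_integral => //.
  - by move=> x _; rewrite lee_fin expR_ge0.
  - apply/measurable_EFinP; apply: measurableT_comp => //.
    by case: hw => mw _ _; exact: measurable_funTS.
  - by move=> x _; rewrite lee_fin ler_expR.
have := expR_ge1Dx alpha; move: le1; rewrite -ler_pdivlMr// mul1r; lra.
Qed.

(** The sum over [k] is at least [ln M1 *+ r] and every other term is at most [(b - a)^-1], so no
    single term can be very negative. This is the origin of [L]. *)
Lemma mixture_data_lower c al w : mixture_data c al w ->
  forall j k, L <= al j k <= (b - a)^-1.
Proof.
move=> [_ _ sal hw] j k; rewrite (log_subdensity_lower_le (hw j k)) andbT.
have := sal j; rewrite (bigD1 k)//= => H.
have H2 : \sum_(i < r | i != k) al j i <= (b - a)^-1 *+ r.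
  apply: (@le_trans _ _ (\sum_(i < r | i != k) (b - a)^-1)).
    by apply: ler_sum => i _; exact: log_subdensity_lower_le (hw j i).
  rewrite sumr_const; apply: ler_wpMn2l; first by rewrite invr_ge0 subr_ge0 ltW.
  by rewrite (leq_trans (max_card _))// card_ord.
rewrite /L; lra.
Qed.

Lemma mixture_data_smooth c al w : mixture_data c al w ->
  forall j k x, x \in `]a, b[ -> L <= smooth a b s (w j k) x <= M2.
Proof.
move=> hd j k x xab; have [_ _ _ hw] := hd.
rewrite (smooth_le hs (mem_itvoo_cc xab) (hw j k)) andbT.
apply: le_trans (smooth_ge hs (mem_itvoo_cc xab) (hw j k)).
by have /andP[] := mixture_data_lower hd j k.
Qed.

Lemma mixture_component_bounds c al w : mixture_data c al w ->
  forall j x, obox x ->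
  expR (L *+ r) <= expR (\sum_(k < r) smooth a b s (w j k) (tnth x k)) <= expR (M2 *+ r).
Proof.
move=> hd j x xab; have H k := mixture_data_smooth hd j k (xab k).
rewrite !ler_expR -[r in L *+ r]card_ord -[r in M2 *+ r]card_ord -!sumr_const.
by apply/andP; split; apply: ler_sum => k _; have /andP[] := H k.
Qed.

Lemma mixture_bounds c al w x : mixture_data c al w -> obox x ->
  expR (L *+ r) <= mixture c w x <= expR (M2 *+ r).
Proof.
move=> hd xab; have [c0 c1 _ _] := hd.
have H j := mixture_component_bounds hd j xab.
rewrite -[expR (L *+ r)]mul1r -[expR (M2 *+ r)]mul1r -c1 !mulr_suml.
by apply/andP; split; apply: ler_sum => j _; rewrite ler_wpM2l//; have /andP[] := H j.
Qed.

Lemma mixture_gt0 c al w x : mixture_data c al w -> obox x -> 0 < mixture c w x.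
Proof.
by move=> hd xab; have /andP[+ _] := mixture_bounds hd xab; apply: lt_le_trans; exact: expR_gt0.
Qed.

Lemma measurable_obox : measurable obox.
Proof.
rewrite (_ : obox = \bigcap_(k : 'I_r) ((fun t : pt R r => tnth t k) @^-1` J)).
  apply: fin_bigcap_measurable => //= k _.
  by rewrite -[X in measurable X]setTI; apply: measurable_tnth => //; exact: measurable_itv.
by apply/seteqP; split => t H k; [move=> _; exact: H|exact: (H k I)].
Qed.

Lemma measurable_mixture c al w : mixture_data c al w -> measurable_fun obox (mixture c w).
Proof.
move=> [_ _ _ hw]; apply: measurable_sum => j; apply: measurable_funM => //.
apply: measurableT_comp => //; apply: measurable_sum => k.
apply: (@measurable_comp _ _ _ _ _ _ (J : set (measurableTypeR R))).
- exact: measurable_itv.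
- by move=> _ [x xab <-] /=; exact: xab.
- exact (measurable_smooth ab hs (hw j k)).
- exact: measurable_funTS (measurable_tnth k).
Qed.

(** The functions to which the objectives [T] are applied; boundedness makes them integrable against
    [g]. *)
Definition tame (h : pt R r -> R) :=
  measurable_fun obox h /\ exists K, forall x, obox x -> `|h x| <= K.

Lemma tame_ln_mixture c al w : mixture_data c al w -> tame (fun x => ln (mixture c w x)).
Proof.
move=> hd; split; first exact: measurableT_comp (measurable_mixture hd).
exists (`|L *+ r| + `|M2 *+ r|) => x xab.
exact: norm_ln_le (mixture_bounds hd xab).
Qed.

(* The mixtures are bounded away from 0, so additive errors are relative errors. *)
Lemma ln_mixture_le c al w c' al' w' (e : R) : 0 <= e ->
  mixture_data c al w -> mixture_data c' al' w' ->
  (forall j, c' j <= c j + e) ->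
  (forall j k x, x \in `]a, b[ ->
     smooth a b s (w' j k) x <= smooth a b s (w j k) x + e) ->
  forall x, obox x -> ln (mixture c' w' x) <=
    ln (mixture c w x) + e * (r%:R + m%:R * expR (M2 *+ r) / expR (L *+ r)).
Proof.
move=> e0 hd hd' cc ww x xab.
have m0 := mixture_gt0 hd xab; have m0' := mixture_gt0 hd' xab.
have /andP[m1 _] := mixture_bounds hd xab.
rewrite mulrDr mulrA; apply: (ln_le_perturb m0' (expR_gt0 _) m1).
  by rewrite mulr_ge0// mulr_ge0// expR_ge0.
apply: (@le_trans _ _ (\sum_(j < m) (c j + e) *
      (expR (e * r%:R) * expR (\sum_(k < r) smooth a b s (w j k) (tnth x k))))).
  apply: ler_sum => j _; have [c0' _ _ _] := hd'.
  rewrite ler_pM ?expR_ge0// -expRD ler_expR.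
  rewrite mulrC mulr_natl -[r in e *+ r]card_ord -sumr_const -big_split /=.
  by apply: ler_sum => k _; rewrite addrC; exact: ww.
have -> : m%:R * expR (M2 *+ r) = \sum_(j < m) expR (M2 *+ r).
  by rewrite sumr_const card_ord mulr_natl.
rewrite mulrDr /mixture !mulr_sumr -big_split /=.
apply: ler_sum => j _; rewrite mulrDl; apply: lerD.
  by rewrite mulrCA.
rewrite mulrCA ler_wpM2l ?expR_ge0// ler_wpM2l//.
by have /andP[] := mixture_component_bounds hd j xab.
Qed.

End Mixture.

Lemma ler_addeps (R : realType) (x y C : R) :
  (forall e, 0 < e -> x <= y + e * C) -> x <= y.
Proof.
move=> H; apply/ler_addgt0Pr => e e0.
have C0 : 0 < `|C| + 1 by rewrite ltr_wpDl.
apply: le_trans (H _ (divr_gt0 e0 C0)) _; rewrite lerD2l.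
rewrite mulrAC ler_pdivrMr// ler_wpM2l ?(ltW e0)//.
by have := ler_norm C; lra.
Qed.

(** * Existence of an optimal normalised mixture *)

Section Maximizer.
Context (R : realType) (r m : nat) (a b M1 M2 B : R) (s : R -> R -> R).
Context (ab : a < b) (hs : smoothing_kernel a b M1 M2 B s).
Notation lambda := (@lebesgue_measure R).
Notation J := (`]a, b[%classic).

Let L := ln M1 *+ r - (b - a)^-1 *+ r.

(** One-sided closeness is enough, as the mixture increases with its weights and smoothings and only
    has to be at least as good as the sequence. *)
Lemma mixture_data_cluster (c : nat -> 'I_m -> R) (al : nat -> 'I_m -> 'I_r -> R)
    (w : nat -> 'I_m -> 'I_r -> R -> R) :
  (forall n, mixture_data a b M1 (c n) (al n) (w n)) ->
  exists c0 al0 w0, mixture_data a b M1 c0 al0 w0 /\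
    forall (e : R) N, 0 < e -> exists2 n, (N <= n)%N &
      (forall j, c n j <= c0 j + e) /\
      (forall j k x, x \in `]a, b[ ->
         smooth a b s (w n j k) x <= smooth a b s (w0 j k) x + e).
Proof.
move=> hd.
(* Smoothings, lower bounds and weights form a single finite family, the last two as constant
   functions, so that one cluster point serves all of them simultaneously. *)
pose I : finType := (('I_m * 'I_r) + ('I_m * 'I_r) + 'I_m)%type.
pose f n (i : I) x := match i with
  | inl (inl jk) => smooth a b s (w n jk.1 jk.2) x
  | inl (inr jk) => al n jk.1 jk.2
  | inr j => c n j end.
pose K := `|L| + M2 + (b - a)^-1 + 1.
have ba : 0 < b - a by rewrite subr_gt0.
have bai : 0 < (b - a)^-1 by rewrite invr_gt0.
have M20 := sk_M2 hs.
have alK n j k : `|al n j k| <= K.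
  have /andP[] := mixture_data_lower ab (hd n) j k; rewrite -/L => lo hi.
  rewrite /K ler_norml; move: lo; case: (ger0P L); lra.
have fK n i x : x \in `]a, b[ -> `|f n i x| <= K.
  case: i => [[[j k]|[j k]]|j] xab //=.
    have /andP[] := mixture_data_smooth ab hs (hd n) j k xab; rewrite -/L => lo hi.
    rewrite /K ler_norml; move: lo; case: (ger0P L); lra.
  have [c_ge0 c_sum _ _] := hd n; have c0 := c_ge0 j.
  have : c n j <= 1 by rewrite -c_sum (bigD1 j)//= lerDl sumr_ge0.
  by rewrite ger0_norm// /K; have := normr_ge0 L; lra.
pose Lam := `|B| * (1 + K * (b - a)).
have K0 : 0 <= K by rewrite /K; have := normr_ge0 L; lra.
have Lam0 : 0 <= Lam by rewrite mulr_ge0// addr_ge0// mulr_ge0// ltW.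
have fLam n i : {in `]a, b[ &, forall x y, `|f n i x - f n i y| <= Lam * `|x - y|}.
  move=> x y xab yab; case: i => [[[j k]|[j k]]|j] /=; last 2 first.
  - by rewrite subrr normr0 mulr_ge0.
  - by rewrite subrr normr0 mulr_ge0.
  have [_ _ _ hw] := hd n.
  apply: le_trans (smooth_lipschitz ab hs xab yab (hw j k)) _.
  rewrite ler_wpM2r// /Lam; apply: (@le_trans _ _ (`|B| * (1 + `|al n j k| * (b - a)))).
    by rewrite ler_wpM2r ?ler_norm// addr_ge0// mulr_ge0// ltW.
  by rewrite ler_wpM2l// lerD2l ler_wpM2r// ltW.
have [phi phiP] := equilipschitz_uniform_cluster ab fK fLam.
pose x0 := (a + b) / 2.
have x0ab : x0 \in `]a, b[ by rewrite in_itv /= /x0; apply/andP; split; lra.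
pose c0 j := phi (inr j) x0.
pose al0 j k := phi (inl (inr (j, k))) x0.
have close e N : 0 < e -> exists2 n, (N <= n)%N &
  [/\ forall j, `|c n j - c0 j| <= e, forall j k, `|al n j k - al0 j k| <= e &
      forall j k x, x \in `]a, b[ ->
        `|smooth a b s (w n j k) x - phi (inl (inl (j, k))) x| <= e].
  move=> e0; have [n Nn H] := phiP e N e0; exists n => //; split.
  - by move=> j; exact: H (inr j) x0 x0ab.
  - by move=> j k; exact: H (inl (inr (j, k))) x0 x0ab.
  - by move=> j k x xab; exact: H (inl (inl (j, k))) x xab.
have w0P jk : exists w0, log_subdensity lambda J (al0 jk.1 jk.2) w0 /\
    forall x, x \in `]a, b[ -> smooth a b s w0 x = phi (inl (inl jk)) x.
  case: jk => j k /=.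
  pose X := {x : R | x \in `]a, b[}.
  have [||e e0|w0 hw0 w0phi] := @log_subdensity_closed _ (measurableTypeR R) R lambda J
    (measurable_itv _) (lebesgue_itv_lty a b) X (fun x u => s u (val x)) M2
    (fun x => phi (inl (inl (j, k))) (val x)) (al0 j k).
  - by move=> x; exact: measurable_funTS (kernel_measurable hs _).
  - by move=> x u _; exact: (kernel_norm_le hs _ (mem_itvoo_cc (valP x))).
  - have [n _ [_ Hal Hs]] := close e 0%N e0; have [_ _ _ hw] := hd n.
    exists (w n j k); last by move=> x; exact: Hs (valP x).
    by apply: log_subdensityW (hw j k); have := Hal j k; rewrite ler_norml; lra.
  - by exists w0; split => // x xab; exact: w0phi (exist _ x xab).
have [w1 w1P] := choice w0P.
exists c0, al0, (fun j k => w1 (j, k)); split.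
  split.
  - move=> j; apply: (@ler_addeps _ _ _ 1) => e e0.
    have [n _ [Hc _ _]] := close e 0%N e0; have [c_ge0 _ _ _] := hd n.
    by have := Hc j; have := c_ge0 j; rewrite ler_norml; lra.
  - have sumE e n : (forall j, `|c n j - c0 j| <= e) ->
        `|\sum_(j < m) c0 j - 1| <= e * m%:R.
      move=> Hc; have [_ c_sum _ _] := hd n; rewrite -[X in _ - X]c_sum -sumrB.
      apply: le_trans (ler_norm_sum _ _ _) _.
      rewrite mulr_natr -[m in _ *+ m]card_ord -sumr_const.
      by apply: ler_sum => j _; rewrite distrC.
    apply/eqP; rewrite eq_le; apply/andP; split; apply: (@ler_addeps _ _ _ m%:R) => e e0.
      by have [n _ [/sumE + _ _]] := close e 0%N e0; rewrite ler_norml; lra.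
    by have [n _ [/sumE + _ _]] := close e 0%N e0; rewrite ler_norml; lra.
  - move=> j; apply: (@ler_addeps _ _ _ r%:R) => e e0.
    have [n _ [_ Hal _]] := close e 0%N e0; have [_ _ sal _] := hd n.
    apply: le_trans (sal j) _.
    rewrite mulr_natr -[r in _ *+ r]card_ord -sumr_const -big_split /=.
    by apply: ler_sum => k _; have := Hal j k; rewrite ler_norml; lra.
  - by move=> j k; have [] := w1P (j, k).
move=> e N e0; have [n Nn [Hc _ Hs]] := close e N e0; exists n => //; split.
  by move=> j; have := Hc j; rewrite ler_norml; lra.
move=> j k x xab; have [_ ->//] := w1P (j, k).
by have := Hs j k x xab; rewrite ler_norml; lra.
Qed.

(** The hypothesis on [T] makes it 1-Lipschitz for the uniform norm on the box: it bounds the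
    supremum and turns uniform errors on log-mixtures into errors on the objective. *)
Lemma exists_maximizer (T : (pt R r -> R) -> R) :
  (forall h h' t, tame a b h -> tame a b h' ->
     (forall x, obox a b x -> h x <= h' x + t) -> T h <= T h' + t) ->
  (exists c al w, @mixture_data R r m a b M1 c al w) ->
  exists c al w, @mixture_data R r m a b M1 c al w /\
    forall c' al' w', @mixture_data R r m a b M1 c' al' w' ->
      T (fun x => ln (mixture a b s c' w' x)) <= T (fun x => ln (mixture a b s c w x)).
Proof.
move=> HT [ci [ali [wi hi]]].
pose E := [set v | exists c al w, @mixture_data R r m a b M1 c al w /\
  v = T (fun x => ln (mixture a b s c w x))].
have Eub : has_ubound E.
  exists (T (cst 0) + (`|L *+ r| + `|M2 *+ r|)) => v [c [al [w [hd ->]]]].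
  apply: HT; first exact (tame_ln_mixture ab hs hd).
    by split; [exact: measurable_cst|exists 0 => x _; rewrite normr0].
  move=> x xab; rewrite add0r; apply: le_trans (ler_norm _) _.
  exact: norm_ln_le (mixture_bounds ab hs hd xab).
have Esup : has_sup E by split => //; exists (T (fun x => ln (mixture a b s ci wi x))); exists ci, ali, wi.
have near_sup n : exists d : ('I_m -> R) * ('I_m -> 'I_r -> R) * ('I_m -> 'I_r -> R -> R),
    mixture_data a b M1 d.1.1 d.1.2 d.2 /\
    sup E - n.+1%:R^-1 < T (fun x => ln (mixture a b s d.1.1 d.2 x)).
  have n0 : 0 < n.+1%:R^-1 :> R by rewrite invr_gt0.
  have [v [c [al [w [hd ->]]]] lt] := sup_adherent n0 Esup.
  by exists (c, al, w).
have [d dP] := choice near_sup.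
have [c [al [w [hd close]]]] := mixture_data_cluster (fun n => (dP n).1).
exists c, al, w; split; first exact: hd.
move=> c' al' w' hd'.
apply: (@le_trans _ _ (sup E)); first by apply: ub_le_sup => //; exists c', al', w'.
pose C := r%:R + m%:R * expR (M2 *+ r) / expR (L *+ r).
apply: (@ler_addeps _ _ _ (C + 1)) => e e0.
(* Indices from [Num.trunc e^-1] on satisfy [n.+1%:R^-1 <= e], so the defect of the maximizing
   sequence also fits into the error [e]. *)
have [n Nn [Hc Hs]] := close e (Num.trunc e^-1) e0.
have ne : n.+1%:R^-1 <= e.
  rewrite -[leRHS]invrK lef_pV2 ?posrE ?invr_gt0//.
  by apply: ltW; apply: lt_le_trans (truncnS_gt _) _; rewrite ler_nat.
have [hdn supn] := dP n.
have H : T (fun x => ln (mixture a b s (d n).1.1 (d n).2 x)) <=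
    T (fun x => ln (mixture a b s c w x)) + e * C.
  apply: HT; [exact (tame_ln_mixture ab hs hdn)|exact (tame_ln_mixture ab hs hd)|].
  by move=> x xab; exact: (ln_mixture_le ab hs (ltW e0) hd hdn Hc Hs).
rewrite mulrDr mulr1 addrA -lerBlDr; apply: le_trans H.
by apply: ltW; apply: le_lt_trans supn; rewrite lerD2l lerN2.
Qed.

End Maximizer.

(** The coordinates vary independently, so the infimum of the sum is the sum of the infima. This
    splits the joint lower bound on a product density into one bound per coordinate. *)
Lemma sum_inf_ge (R : realType) (r : nat) (A : set R) (f : 'I_r -> R -> R) (v : R) :
  A !=set0 -> (forall x : 'I_r -> R, (forall k, A (x k)) -> v <= \sum_(k < r) f k (x k)) ->
  exists al : 'I_r -> R, (forall k t, A t -> al k <= f k t) /\ v <= \sum_(k < r) al k.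
Proof.
move=> [t0 At0] H.
have lb k : has_lbound (f k @` A).
  (* Freezing the other coordinates at [t0] bounds [f k] from below. *)
  exists (v - \sum_(i < r | i != k) f i t0) => _ [t At <-].
  have Aif i : A (if i == k then t else t0) by case: ifP.
  have := H (fun i => if i == k then t else t0) Aif.
  rewrite (bigD1 k)//= eqxx lerBlDr => /le_trans; apply; rewrite lerD2l.
  by apply: ler_sum => i /negbTE ->.
have hi k : has_inf (f k @` A) by split => //; exists (f k t0); exists t0.
exists (fun k => inf (f k @` A)); split.
  by move=> k t At; apply: ge_inf => //; exists t.
apply: (@ler_addeps _ _ _ r%:R) => e e0.
have ex k : exists t, A t /\ f k t < inf (f k @` A) + e.
  by have [_ [t At <-] lt] := inf_adherent e0 (hi k); exists t.
have [x xP] := choice ex.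
apply: le_trans (H x (fun k => (xP k).1)) _.
rewrite mulr_natr -[r in _ *+ r]card_ord -sumr_const -big_split /=.
by apply: ler_sum => k _; rewrite ltW//; have [] := xP k.
Qed.

(** [sg j] is the component that slot [j] copies: itself if its weight is nonzero, [j0] otherwise.
    The weight of [i] is split equally over the [N i] slots that copy it, and [N i = 0] only if
    [c i = 0]. *)
Lemma positive_reweighting (R : realFieldType) (m : nat) (c : 'I_m -> R) :
  (forall j, 0 <= c j) -> \sum_(j < m) c j = 1 ->
  exists (sg : 'I_m -> 'I_m) (c' : 'I_m -> R), (forall j, 0 < c' j) /\
    forall X : 'I_m -> R, \sum_(j < m) c' j * X (sg j) = \sum_(j < m) c j * X j.
Proof.
move=> c0 c1.
have [j0 cj0] : exists j0, c j0 != 0.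
  apply: contrapT => H; have : \sum_(j < m) c j = 0.
    by apply: big1 => j _; apply: contrapT => /eqP cj; apply: H; exists j.
  by rewrite c1 => /eqP; rewrite oner_eq0.
pose sg j := if c j == 0 then j0 else j.
have csg j : 0 < c (sg j) by rewrite lt_neqAle c0 andbT eq_sym /sg; case: ifPn.
pose N i := #|[pred j | sg j == i]|.
have Nsg j : 0 < (N (sg j))%:R :> R.
  by rewrite ltr0n; apply/card_gt0P; exists j; rewrite inE.
exists sg, (fun j => c (sg j) / (N (sg j))%:R); split.
  by move=> j; rewrite divr_gt0.
move=> X; rewrite (partition_big sg xpredT)//=; apply: eq_bigr => i _.
under eq_bigr => j /eqP -> do [].
rewrite sumr_const -/(N i).
have [Ni|Ni] := posnP (N i); last first.
  by rewrite -[LHS]mulr_natr mulrAC divfK// pnatr_eq0 -lt0n.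
rewrite Ni mulr0n; suff -> : c i = 0 by rewrite mul0r.
apply: contrapT => /eqP ci; move: Ni => /eqP; rewrite -leqn0 leqNgt => /negP; apply.
by apply/card_gt0P; exists i; rewrite inE /sg (negbTE ci).
Qed.

(** * Smoothing of functions in product form *)

Section ProductForm.
Context (R : realType) (r : nat) (a b M1 M2 B : R) (s : R -> R -> R).
Context (ab : a < b) (hs : smoothing_kernel a b M1 M2 B s).
Notation lambda := (@lebesgue_measure R).
Notation J := (`]a, b[%classic).

Context (th : R) (ek : 'I_r -> R -> R) (th_gt0 : 0 < th).
Context (ek_L1 : forall k, L1 (ek k)).
Context (ek_gt0 : forall k t, t \in `[a, b] -> 0 < ek k t).
Context (ek_out : forall k t, t \notin `[a, b] -> ek k t = 0).

Lemma Rintegral_product_factor k : \int[lambda]_t ek k t = \int[lambda]_(t in J) ek k t.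
Proof.
rewrite /Rintegral (@integral_support_itv _ a b)//; first exact: L1_measurable.
by move=> t; exact: ek_out.
Qed.

Lemma integrable_product_form :
  (leb r).-integrable [set: pt R r] (EFin \o product_form th ek).
Proof. exact: integrable_EFinZl (integral_leb_prod ek_L1).1. Qed.

Lemma integral_product_form : (\int[leb r]_x (product_form th ek x)%:E =
  (th * \prod_(k < r) \int[lambda]_(t in J) ek k t)%:E)%E.
Proof.
have [i1 i2] := integral_leb_prod ek_L1.
under eq_integral do rewrite EFinM; rewrite integralZl// i2 EFinM.
by congr (_ * _%:E)%E; apply: eq_bigr => k _; exact: Rintegral_product_factor.
Qed.

Lemma product_form_gt0 u : cube a b u -> 0 < product_form th ek u.
Proof. by move=> uab; rewrite mulr_gt0// prodr_gt0// => k _; exact: ek_gt0. Qed.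

Lemma ln_product_form u : cube a b u ->
  ln (product_form th ek u) = ln th + \sum_(k < r) ln (ek k (tnth u k)).
Proof.
move=> uab; apply: expR_inj; rewrite expRD expR_ln ?product_form_gt0// expR_ln//.
rewrite expR_sum; congr (_ * _); apply: eq_bigr => k _.
by rewrite expR_ln//; exact/ek_gt0/uab.
Qed.

Lemma L1_kernel x : x \in `[a, b] -> L1 (s ^~ x).
Proof.
move=> xab; apply: (@L1_support_itv _ a b).
- exact: kernel_measurable hs x.
- by move=> t tab; rewrite (kernel_out hs).
- exact (integrable_kernel hs xab).
Qed.

Lemma L1_kernel_ln k x : x \in `[a, b] ->
  lambda.-integrable J (EFin \o (fun t => ln (ek k t))) ->
  L1 (fun t => s t x * ln (ek k t)).
Proof.
move=> xab il; apply: (@L1_support_itv _ a b).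
- apply: measurable_funM; first exact: (kernel_measurable hs x).
  by apply: measurableT_comp => //; exact: L1_measurable.
- by move=> t tab; rewrite (kernel_out hs)// mul0r.
- exact: (integrable_kernel_mul hs).
Qed.

(** The logarithm turns the product into a sum, and in each summand the kernel factors of the other
    coordinates integrate to 1. *)
Lemma nl_smooth_product_form x :
  (forall k, lambda.-integrable J (EFin \o (fun t => ln (ek k t)))) -> cube a b x ->
  nl_smooth a b s (product_form th ek) x =
  th * expR (\sum_(k < r) smooth a b s (fun t => ln (ek k t)) (tnth x k)).
Proof.
move=> il xab.
pose G k t := s t (tnth x k).
have G1 k : L1 (G k) by exact/L1_kernel/xab.
(* [F l] is the integrand of the [l]-th summand, with the logarithm in coordinate [l] alone. *)
pose F (l k : 'I_r) t := s t (tnth x k) * (if k == l then ln (ek k t) else 1).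
have F1 l k : L1 (F l k).
  rewrite /F; case: eqP => _; first exact: L1_kernel_ln (xab k) (il k).
  by under eq_fun do rewrite mulr1; exact: G1.
have [iG eG] := integral_leb_prod G1.
have intG k : \int[lambda]_t G k t = 1.
  by rewrite /Rintegral (sk_int1 hs (xab k)).
have intF l : \prod_(k < r) \int[lambda]_t F l k t =
    smooth a b s (fun t => ln (ek l t)) (tnth x l).
  rewrite (bigD1 l)//= big1 ?mulr1; last first.
    move=> k kl; rewrite -[RHS](intG k); apply: eq_Rintegral => t _.
    by rewrite /F (negbTE kl) mulr1.
  rewrite /smooth /Rintegral; congr fine.
  rewrite -(@integral_support_itv _ a b (fun t => s t (tnth x l) * ln (ek l t))).
  - by apply: eq_integral => t _; rewrite /F eqxx.
  - exact (L1_measurable (L1_kernel_ln (xab l) (il l))).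
  - by move=> t tab; rewrite (kernel_out hs)// mul0r.
have adj : adj_smooth s (fun u => lne (product_form th ek u)%:E) x =
    (ln th + \sum_(l < r) smooth a b s (fun t => ln (ek l t)) (tnth x l))%:E.
  rewrite /adj_smooth.
  transitivity (\int[leb r]_u ((ln th * \prod_(k < r) G k (tnth u k))%:E
     + \sum_(l < r) (\prod_(k < r) F l k (tnth u k))%:E))%E.
    apply: eq_integral => u _; rewrite sumEFin -EFinD.
    have [uab|/existsNP[k uk]] := pselect (cube a b u).
      rewrite lne_EFin ?product_form_gt0// -EFinM ln_product_form// mulrDr mulrC.
      congr ((_ + _)%:E); rewrite mulr_sumr; apply: eq_bigr => l _.
      rewrite /F big_split /=; congr (_ * _).
      by rewrite (bigD1 l)//= eqxx big1 ?mulr1// => k /negbTE ->.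
    (* Off the cube a kernel factor vanishes, which cancels the logarithm even where it is [-oo]. *)
    have s0 : s (tnth u k) (tnth x k) = 0 by rewrite (kernel_out hs)//; exact/negP.
    have p0 : prod_kernel s u x = 0 by rewrite /prod_kernel (bigD1 k)//= s0 mul0r.
    have g0 : \prod_(i < r) G i (tnth u i) = 0 by exact: p0.
    rewrite p0 g0 mul0e mulr0 add0r big1// => l _.
    by rewrite (bigD1 k)//= /F s0 !mul0r.
  have iF l := (integral_leb_prod (F1 l)).1.
  have e1 : (\int[leb r]_u (ln th * \prod_(k < r) G k (tnth u k))%:E = (ln th)%:E)%E.
    under eq_integral do rewrite EFinM.
    by rewrite integralZl// eG (eq_bigr _ (fun k _ => intG k)) big1_eq mule1.
  have e2 l : (\int[leb r]_u (\prod_(k < r) F l k (tnth u k))%:E =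
      (smooth a b s (fun t => ln (ek l t)) (tnth x l))%:E)%E.
    by rewrite (integral_leb_prod (F1 l)).2 intF.
  rewrite integralD//; last 2 first.
  - exact: integrable_EFinZl.
  - exact: integrable_sum.
  by rewrite e1 integral_sum// (eq_bigr _ (fun l _ => e2 l)) sumEFin -EFinD.
rewrite /nl_smooth mem_set// adj /= expRD expR_ln//.
Qed.

End ProductForm.

(** * From admissible components to log-subdensities and back *)

Section Component.
Context (R : realType) (r : nat) (a b M1 M2 B : R) (s : R -> R -> R).
Context (ab : a < b) (hs : smoothing_kernel a b M1 M2 B s).
Notation lambda := (@lebesgue_measure R).
Notation J := (`]a, b[%classic).

Let mJ : measurable (J : set (measurableTypeR R)) := measurable_itv _.
Let lJ := lebesgue_itv_lty a b.

Lemma eq_smooth (w w' : R -> R) : {in `]a, b[, w =1 w'} ->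
  smooth a b s w =1 smooth a b s w'.
Proof.
move=> ww x; apply: eq_Rintegral => u; rewrite inE /= => uab.
by rewrite ww.
Qed.

Lemma smooth_shift (w : R -> R) (z x : R) : x \in `[a, b] ->
  lambda.-integrable J (EFin \o w) ->
  smooth a b s (fun t => w t + z) x = smooth a b s w x + z.
Proof.
move=> xab iw.
have is_ := integrable_kernel hs xab.
have isw := integrable_kernel_mul hs xab iw.
have isz := integrable_kernel_mul hs xab (integrable_cst_finite mJ lJ z).
rewrite /smooth; under eq_Rintegral do rewrite mulrDr.
by rewrite RintegralD// RintegralZr// (integral_kernel hs xab) mul1r.
Qed.

Lemma expR_lnMn (x : R) n : 0 < x -> expR (ln x *+ n) = x ^+ n.
Proof. by move=> x0; rewrite -mulr_natl expRM_natl expR_ln. Qed.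

(** Convertible to what [admissible] demands at each index, so components can be treated one at a
    time. *)
Definition admissible_component (f : pt R r -> R) :=
  (exists (th : R) (ek : 'I_r -> R -> R),
      [/\ 0 < th,
          forall k, L1 (ek k),
          forall k t, t \in `[a, b] -> 0 < ek k t,
          forall k t, t \notin `[a, b] -> ek k t = 0 &
          forall x, f x = product_form th ek x]) /\
    (forall x, cube a b x -> M1 ^+ r <= f x / \int[leb r]_y f y).

Lemma component_normal_form f : admissible_component f ->
  exists C al w, [/\ 0 < C, ln M1 *+ r <= \sum_(k < r) al k,
    forall k, log_subdensity lambda J (al k) (w k),
    (leb r).-integrable [set: pt R r] (EFin \o f) /\ \int[leb r]_x f x = C &
    forall x, obox a b x ->
      nl_smooth a b s f x = C * expR (\sum_(k < r) smooth a b s (w k) (tnth x k))].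
Proof.
move=> [[th [ek [th0 ek1 ekp eko fE]]] fM].
have {}fE : f = product_form th ek by exact/funext.
rewrite {}fE in fM *.
pose Z k := \int[lambda]_(t in J) ek k t; pose C := th * \prod_(k < r) Z k.
have fC : \int[leb r]_x product_form th ek x = C.
  by rewrite /Rintegral (integral_product_form th ek1 eko).
rewrite fC in fM.
have M10 := sk_M1 hs.
have aab : a \in `[a, b] by rewrite in_itv /= lexx ltW.
(* If [C] were 0, the quotient in the lower bound would be 0 by the convention on division, against
   [M1 ^+ r > 0]. *)
have C_neq0 : C != 0.
  apply: contraTneq (fM [tuple a | k < r] (fun k => ltac:(by rewrite tnth_mktuple))) => ->.
  by rewrite invr0 mulr0 -ltNge exprn_gt0.
have Z_ge0 k : 0 <= Z k.
  by apply: Rintegral_ge0 => t /mem_itvoo_cc tab; exact/ltW/ekp.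
have Z_gt0 k : 0 < Z k.
  rewrite lt_neqAle Z_ge0 andbT eq_sym; apply: contraNneq C_neq0 => Zk.
  by rewrite /C (bigD1 k)//= Zk mul0r mulr0.
have C_gt0 : 0 < C by rewrite mulr_gt0// prodr_gt0.
pose g k t := ln (ek k t / Z k).
have gE k t : t \in `[a, b] -> expR (g k t) = ek k t / Z k.
  by move=> tab; rewrite expR_ln// divr_gt0// ekp.
have [||al [alg sal]] := @sum_inf_ge _ _ `[a, b]%classic g (ln M1 *+ r).
- by exists a.
- move=> x xab; rewrite -ler_expR expR_lnMn// expR_sum.
  have := fM [tuple x k | k < r] (fun k => ltac:(by rewrite tnth_mktuple; exact: xab)).
  rewrite /product_form /C invfM mulrACA divff ?gt_eqF// mul1r -prodfV -big_split /=.
  rewrite (eq_bigr (fun k => expR (g k (x k)))) => [//|k _].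
  by rewrite tnth_mktuple gE//; exact: xab.
(* On [[a, b]] the maximum equals [g k]; outside it supplies the lower bound that [log_subdensity]
   wants on the whole line. *)
pose w k t := Num.max (al k) (g k t).
have wJ k : {in `[a, b], w k =1 g k} by move=> t tab; rewrite /w max_r// alg.
have mek k : measurable_fun [set: measurableTypeR R] (ek k : measurableTypeR R -> measurableTypeR R).
  exact: L1_measurable.
have iek k : lambda.-integrable J (EFin \o ek k).
  by apply: integrableS (ek1 k) => //; exact: measurable_itv.
have hw k : log_subdensity lambda J (al k) (w k).
  split.
  - apply: measurable_maxr => //; apply: measurableT_comp => //.
    by apply: measurable_funM => //; exact: mek.
  - by move=> t; rewrite /w le_max lexx.
  - have -> : (\int[lambda]_(t in J) (expR (w k t))%:E =
        \int[lambda]_(t in J) (ek k t / Z k)%:E)%E.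
      apply: eq_integral => t; rewrite inE /= => /mem_itvoo_cc tab.
      by rewrite (wJ k t tab) (gE k t tab).
    rewrite -[leLHS]fineK; last first.
      apply: (integrable_fin_num mJ).
      by apply: eq_integrable (integrable_EFinZl mJ (Z k)^-1 (iek k)) => // t _ /=; rewrite mulrC.
    have : \int[lambda]_(t in J) (ek k t / Z k) = 1.
      by rewrite RintegralZr//; apply: divff; exact: lt0r_neq0 (Z_gt0 k).
    by rewrite /Rintegral => ->.
have lnek k : {in `]a, b[, (fun t => ln (ek k t)) =1 (fun t => w k t + ln (Z k))}.
  move=> t /mem_itvoo_cc tab; rewrite wJ//; apply: expR_inj.
  by rewrite expRD gE// !expR_ln// ?ekp// divfK// gt_eqF.
have iw k := log_subdensity_integrable mJ lJ (hw k).
have il k : lambda.-integrable J (EFin \o (fun t => ln (ek k t))).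
  apply: eq_integrable (integrable_EFinD mJ (iw k) (integrable_cst_finite mJ lJ (ln (Z k)))) => //.
  by move=> t; rewrite inE /= => tab; rewrite lnek.
exists C, al, w; split => //; first by split => //; exact: integrable_product_form.
move=> x xab; have xcc k := mem_itvoo_cc (xab k).
rewrite (nl_smooth_product_form hs th0 ek1 ekp il)//.
rewrite (eq_bigr (fun k => smooth a b s (w k) (tnth x k) + ln (Z k))); last first.
  by move=> k _; rewrite (eq_smooth (lnek k)) smooth_shift.
rewrite big_split /= expRD.
have -> : expR (\sum_(k < r) ln (Z k)) = \prod_(k < r) Z k.
  by rewrite expR_sum; apply: eq_bigr => k _; exact: expR_ln.
by rewrite /C mulrCA mulrC.
Qed.

(** Normalising [expR (w k)] divides it by [Z k <= 1]: the pointwise lower bound is preserved and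
    the smoothing gains [- ln (Z k) >= 0]. *)
Lemma admissible_component_of_log_subdensity (C : R) (al : 'I_r -> R) (w : 'I_r -> R -> R) :
  0 < C -> ln M1 *+ r <= \sum_(k < r) al k ->
  (forall k, log_subdensity lambda J (al k) (w k)) ->
  exists f, [/\ admissible_component f, \int[leb r]_x f x = C &
    forall x, obox a b x ->
      C * expR (\sum_(k < r) smooth a b s (w k) (tnth x k)) <= nl_smooth a b s f x].
Proof.
move=> C0 sal hw.
pose Z k := \int[lambda]_(t in J) expR (w k t).
have ie k := log_subdensity_integrable_expR (hw k).
have Z_gt0 k : 0 < Z k.
  have ba : 0 < expR (al k) * (b - a) by rewrite mulr_gt0 ?expR_gt0// subr_gt0.
  apply: lt_le_trans ba _.
  have -> : expR (al k) * (b - a) = \int[lambda]_(t in J) expR (al k).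
    rewrite Rintegral_cst//; congr (_ * _).
    have lJE : fine (lambda J) = b - a by rewrite lebesgue_measure_itv /= lte_fin ab.
    by rewrite -lJE.
  apply: le_Rintegral => //; first exact: (integrable_cst_finite mJ lJ).
  by move=> t _; rewrite ler_expR; have [_ + _] := hw k; exact.
have Z_le1 k : Z k <= 1.
  have [_ _ w1] := hw k; rewrite -lee_fin fineK//.
  exact: (integrable_fin_num mJ (ie k)).
pose ek k t := if t \in `[a, b] then expR (w k t) / Z k else 0.
have ekp k t : t \in `[a, b] -> 0 < ek k t.
  by move=> tab; rewrite /ek tab divr_gt0// expR_gt0.
have eko k t : t \notin `[a, b] -> ek k t = 0 by rewrite /ek => /negbTE ->.
have mek k : measurable_fun [set: measurableTypeR R] (ek k : measurableTypeR R -> measurableTypeR R).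
  apply: measurable_fun_ifT => //.
    apply: (@measurable_fun_bool _ _ _ _ true); rewrite setTI.
    rewrite (_ : _ @^-1` _ = `[a, b]%classic); first exact: measurable_itv.
    by apply/seteqP; split => t.
  apply: measurable_funM => //; apply: measurableT_comp => //.
  by have [mw _ _] := hw k.
have ekJ k : {in `]a, b[, ek k =1 (fun t => expR (w k t) / Z k)}.
  by move=> t /mem_itvoo_cc tab; rewrite /ek tab.
have iekJ k : lambda.-integrable J (EFin \o (fun t => (Z k)^-1 * expR (w k t))).
  exact: (integrable_EFinZl mJ).
have iek k : lambda.-integrable J (EFin \o ek k).
  apply: eq_integrable (iekJ k) => // t; rewrite inE /= => tab.
  by rewrite ekJ// mulrC.
have ek1 k : L1 (ek k) by apply: (@L1_support_itv _ a b) => //; exact: eko.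
have intek k : \int[lambda]_(t in J) ek k t = 1.
  transitivity (\int[lambda]_(t in J) ((Z k)^-1 * expR (w k t))).
    by apply: eq_Rintegral => t; rewrite inE /= => tab; rewrite ekJ// mulrC.
  by rewrite RintegralZl//; apply: mulVf; exact: lt0r_neq0 (Z_gt0 k).
have fC : \int[leb r]_x product_form C ek x = C.
  by rewrite /Rintegral (integral_product_form C ek1 eko) /= (eq_bigr _ (fun k _ => intek k)) big1_eq mulr1.
have lnek k : {in `]a, b[, (fun t => ln (ek k t)) =1 (fun t => w k t + - ln (Z k))}.
  move=> t tab; have tcc := mem_itvoo_cc tab; apply: expR_inj.
  by rewrite expRD expRN !expR_ln// ?ekp// ekJ.
have iw k := log_subdensity_integrable mJ lJ (hw k).
have il k : lambda.-integrable J (EFin \o (fun t => ln (ek k t))).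
  apply: eq_integrable (integrable_EFinD mJ (iw k) (integrable_cst_finite mJ lJ (- ln (Z k)))) => //.
  by move=> t; rewrite inE /= => tab; rewrite lnek.
exists (product_form C ek); split => //.
  split; first by exists C, ek.
  move=> x xab; rewrite fC /product_form mulrAC divff ?gt_eqF// mul1r.
  rewrite -(expR_lnMn _ (sk_M1 hs)); apply: (@le_trans _ _ (expR (\sum_(k < r) al k))).
    by rewrite ler_expR.
  rewrite expR_sum; apply: ler_prod => k _; rewrite expR_ge0 /= /ek (xab k).
  rewrite ler_pdivlMr//; apply: (@le_trans _ _ (expR (al k))).
    by rewrite ler_piMr// expR_ge0.
  by rewrite ler_expR; have [_ + _] := hw k; exact.
move=> x xab; have xcc k := mem_itvoo_cc (xab k).
rewrite (nl_smooth_product_form hs C0 ek1 ekp il)//.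
rewrite ler_wpM2l ?(ltW C0)// ler_expR; apply: ler_sum => k _.
rewrite (eq_smooth (lnek k)) smooth_shift// lerDl oppr_ge0.
exact: ln_le0.
Qed.

End Component.

Lemma ln_le_subr1 (R : realType) (x : R) : 0 < x -> ln x <= x - 1.
Proof. by move=> x0; rewrite lerBrDl -[leRHS]expR_ln// expR_ge1Dx. Qed.

(** * Existence of an optimal admissible candidate *)

Section Optimal.
Context (R : realType) (r m : nat) (a b M1 M2 B : R) (s : R -> R -> R).
Context (ab : a < b) (hs : smoothing_kernel a b M1 M2 B s).
Notation lambda := (@lebesgue_measure R).
Notation J := (`]a, b[%classic).

Let mJ : measurable (J : set (measurableTypeR R)) := measurable_itv _.
Let lJ := lebesgue_itv_lty a b.

Definition smoothed_mixture (e : 'I_m -> pt R r -> R) x :=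
  \sum_(j < m) nl_smooth a b s (e j) x.

Definition total_mass (e : 'I_m -> pt R r -> R) := \sum_(j < m) \int[leb r]_x e j x.

(** The weights are the shares of the components in the total mass, which separates the scale of [e]
    from its shape. *)
Lemma admissible_mixture (m_gt0 : (0 < m)%N) e : admissible a b M1 e ->
  exists (c : 'I_m -> R) al w, [/\ 0 < total_mass e, mixture_data a b M1 c al w,
    (\int[leb r]_x (\sum_(j < m) e j x)%:E = (total_mass e)%:E)%E &
    forall x, obox a b x -> smoothed_mixture e x = total_mass e * mixture a b s c w x].
Proof.
move=> he.
have [p pP] := choice (fun j => component_normal_form ab hs (he j)).
have {pP}[al pP] := choice pP; have {pP}[w pP] := choice pP.
have mE j : \int[leb r]_x e j x = p j by have [_ _ _ []] := pP j.
have massE : total_mass e = \sum_(j < m) p j by apply: eq_bigr => j _.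
have p0 j : 0 < p j by have [] := pP j.
have mass0 : 0 < total_mass e.
  rewrite massE (bigD1 (Ordinal m_gt0))//=; apply: ltr_pwDl; first exact: p0.
  by apply: sumr_ge0 => j _; exact: ltW.
exists (fun j => p j / total_mass e), al, w; split => //.
- split.
  + by move=> j; rewrite divr_ge0// ltW.
  + by rewrite -mulr_suml -massE divff// gt_eqF.
  + by move=> j; have [] := pP j.
  + by move=> j k; have [_ _ + _ _] := pP j; exact.
- have ie j : (leb r).-integrable [set: pt R r] (EFin \o e j) by have [_ _ _ []] := pP j.
  under eq_integral do rewrite -sumEFin.
  rewrite integral_sum// massE -sumEFin; apply: eq_bigr => j _.
  by rewrite -mE /Rintegral fineK//; exact: (integrable_fin_num _ (ie j)).
- move=> x xab; rewrite /smoothed_mixture /mixture mulr_sumr; apply: eq_bigr => j _.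
  have [_ _ _ _ ->//] := pP j.
  by rewrite mulrA mulrCA divff ?mulr1// gt_eqF.
Qed.

(** Sharing weights leaves the mixture unchanged, and renormalising the components can only raise
    it. *)
Lemma mixture_admissible c al w : @mixture_data R r m a b M1 c al w ->
  exists e, [/\ admissible a b M1 e, total_mass e = 1 &
    forall x, obox a b x -> mixture a b s c w x <= smoothed_mixture e x].
Proof.
move=> [c0 c1 sal hw].
have [sg [c' [c'0 c'E]]] := positive_reweighting c0 c1.
have [e eP] := choice (fun j => admissible_component_of_log_subdensity ab hs
  (c'0 j) (sal (sg j)) (hw (sg j))).
exists e; split.
- by move=> j; have [] := eP j.
- rewrite /total_mass (eq_bigr c') => [|j _]; last by have [] := eP j.
  rewrite -c1 -[LHS](eq_bigr _ (fun j _ => mulr1 (c' j))) (c'E (fun=> 1)).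
  by apply: eq_bigr => j _; rewrite mulr1.
- move=> x xab; rewrite /mixture -c'E; apply: ler_sum => j _.
  by have [_ _ +] := eP j; exact.
Qed.

Lemma exists_mixture_data (m_gt0 : (0 < m)%N) :
  exists c al w, @mixture_data R r m a b M1 c al w.
Proof.
exists (fun=> m%:R^-1), (fun _ _ => ln M1), (fun _ _ _ => ln M1).
have M10 := sk_M1 hs; split.
- by move=> j; rewrite invr_ge0.
- by rewrite sumr_const card_ord -[LHS]mulr_natr mulVf// pnatr_eq0 -lt0n.
- by move=> j; rewrite sumr_const card_ord.
- move=> _ _; split => //; rewrite expR_ln// integral_cst; last exact: measurable_itv.
  have lJE : lambda J = (b - a)%:E by rewrite lebesgue_measure_itv /= lte_fin ab -EFinB.
  rewrite [X in (_ * X)%E](_ : _ = (b - a)%:E); last exact: lJE.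
  rewrite -EFinM lee_fin.
  pose x := (a + b) / 2.
  have xab : x \in `[a, b] by rewrite in_itv /= !midf_le// ltW.
  (* The constant [M1] is a subdensity because it lies below the probability density [s ^~ x]. *)
  rewrite -(integral_kernel hs xab).
  have -> : M1 * (b - a) = \int[lambda]_(t in J) M1.
    rewrite Rintegral_cst; last exact: measurable_itv.
    congr (_ * _).
    by rewrite -[b - a]/(fine (b - a)%:E) -lJE.
  apply: le_Rintegral.
  + exact: measurable_itv.
  + exact: (integrable_cst_finite mJ lJ).
  + exact (integrable_kernel hs xab).
  + by move=> u /mem_itvoo_cc uab; have /andP[] := sk_bounds hs uab xab.
Qed.

Lemma tame_ln_smoothed_mixture (m_gt0 : (0 < m)%N) e : admissible a b M1 e ->
  tame a b (fun x => ln (smoothed_mixture e x)) /\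
  exists2 K, forall x, obox a b x -> smoothed_mixture e x <= K &
    forall x, obox a b x -> 0 < smoothed_mixture e x.
Proof.
move=> he; have [c [al [w [C0 hd _ DE]]]] := admissible_mixture m_gt0 he.
have [mt [K tK]] := tame_ln_mixture ab hs hd.
have lnE x : obox a b x -> ln (smoothed_mixture e x) =
    ln (total_mass e) + ln (mixture a b s c w x).
  move=> xab; rewrite DE//; exact: lnM C0 (mixture_gt0 ab hs hd xab).
split; first split.
- apply: (@eq_measurable_fun _ _ _ _ _ (fun x => ln (total_mass e) + ln (mixture a b s c w x))).
    by move=> x; rewrite inE => xab; rewrite lnE.
  by apply: measurable_funD.
- exists (`|ln (total_mass e)| + K) => x xab; rewrite lnE//.
  by apply: le_trans (ler_normD _ _) _; rewrite lerD2l; exact: tK.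
exists (total_mass e * expR (M2 *+ r)) => x xab; rewrite DE//.
  have /andP[_ hi] := mixture_bounds ab hs hd xab.
  by rewrite ler_wpM2l// ltW.
exact: mulr_gt0 C0 (mixture_gt0 ab hs hd xab).
Qed.

(* Since T commutes with adding constants, rescaling [e] to total mass 1 can only
   improve the objective, by [ln C <= C - 1]. *)
Lemma exists_optimal_admissible (m_gt0 : (0 < m)%N) (T : (pt R r -> R) -> R) :
  (forall h h' t, tame a b h -> tame a b h' ->
     (forall x, obox a b x -> h x <= h' x + t) -> T h <= T h' + t) ->
  exists2 e0, admissible a b M1 e0 & forall e, admissible a b M1 e ->
    T (fun x => ln (smoothed_mixture e x)) - total_mass e <=
    T (fun x => ln (smoothed_mixture e0 x)) - total_mass e0.
Proof.
move=> HT.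
have arith (t1 t2 t3 t4 l C : R) : t1 <= t2 + l -> t3 <= t4 + 0 -> t2 <= t3 ->
    l <= C - 1 -> t1 - C <= t4 - 1 by lra.
have [c [al [w [hd opt]]]] := exists_maximizer ab hs HT (exists_mixture_data m_gt0).
have [e0 [he0 e01 e0D]] := mixture_admissible hd.
exists e0; first exact: he0.
move=> e he; have [c' [al' [w' [C0 hd' _ DE]]]] := admissible_mixture m_gt0 he.
have [te _] := tame_ln_smoothed_mixture m_gt0 he.
have [te0 _] := tame_ln_smoothed_mixture m_gt0 he0.
have step1 : T (fun x => ln (smoothed_mixture e x)) <=
    T (fun x => ln (mixture a b s c' w' x)) + ln (total_mass e).
  apply: HT; [exact: te|exact (tame_ln_mixture ab hs hd')|].
  move=> x xab; rewrite DE// addrC.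
  by rewrite (lnM C0 (mixture_gt0 ab hs hd' xab)).
have step2 : T (fun x => ln (mixture a b s c w x)) <=
    T (fun x => ln (smoothed_mixture e0 x)) + 0.
  apply: HT; [exact (tame_ln_mixture ab hs hd)|exact: te0|].
  move=> x xab; rewrite addr0 -ler_expR.
  have mix0 := mixture_gt0 ab hs hd xab.
  rewrite (expR_ln mix0) expR_ln ?e0D//; exact: lt_le_trans mix0 (e0D _ xab).
rewrite e01; apply: (arith _ _ _ _ _ _ step1 step2 (opt _ _ _ hd')).
exact: ln_le_subr1.
Qed.

End Optimal.

(** Balls of row vectors are those of the sup norm, so shifting all coordinates by [e / 2] either
    way stays in the cube. *)
Lemma icube_obox (R : realType) (r : nat) (a b : R) (x : pt R r) :
  icube a b x -> obox a b x.
Proof.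
move=> /nbhs_ballP[e /= e0 eball] k.
have shift d : `|d| < e -> tnth x k + d \in `[a, b].
  move=> de; have [|z zab zE] := eball (\row_j (tnth x j + d)).
    by split=> // i j; rewrite !mxE /ball /= opprD addrA subrr add0r normrN.
  have := congr1 (fun v : 'rV[R]_r => v ord0 k) zE; rewrite !mxE => <-; exact: zab.
have h : `|e / 2| < e by rewrite gtr0_norm ?divr_gt0//; lra.
have := shift _ h; have := shift (- (e / 2)); rewrite normrN => /(_ h).
rewrite !in_itv /=; lra.
Qed.

(** On a set of finite measure the lower bound makes the integral of the negative part finite, so
    non-integrability can only come from the positive part. *)
Lemma measurable_integral_pinfty d (T : measurableType d) (R : realType)
    (mu : {measure set T -> \bar R}) (D : set T) (f : T -> R) (K : R) :
  measurable D -> (mu D < +oo)%E -> measurable_fun D f ->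
  (forall x, D x -> - K <= f x) -> ~ mu.-integrable D (EFin \o f) ->
  (\int[mu]_(x in D) (f x)%:E = +oo)%E.
Proof.
move=> mD muD mf fK nif.
have mF : measurable_fun D (EFin \o f) by exact/measurable_EFinP.
have iK : mu.-integrable D (EFin \o cst `|K|) by exact: integrable_cst_finite.
have ineg : (\int[mu]_(x in D) (EFin \o f)^\- x < +oo)%E.
  apply: le_lt_trans (integrable_lty mD iK).
  apply: ge0_le_integral => //; [exact: measurable_funeneg|exact: measurable_int iK|].
  move=> x Dx; rewrite funenegE ge_max /= !lee_fin normr_ge0 andbT.
  by have := fK x Dx; have := ler_norm K; lra.
have ipos : (\int[mu]_(x in D) (EFin \o f)^\+ x = +oo)%E.
  apply/eqP; rewrite -leye_eq leNgt; apply/negP => ipos; apply: nif.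
  apply/integrableP; split => //.
  rewrite (eq_integral (fun x => (EFin \o f)^\+ x + (EFin \o f)^\- x)%E).
    rewrite ge0_integralD//; first exact: lte_add_pinfty.
      exact: measurable_funepos.
    exact: measurable_funeneg.
  by move=> x _; rewrite -/((abse \o (EFin \o f)) x) fune_abse.
rewrite integralE; have -> : (\int[mu]_(x in D) (fun x => (f x)%:E)^\+ x = +oo)%E by exact: ipos.
rewrite addye// -ltNye -lteN2 oppeK; apply: lt_le_trans (ineg) _.
by [].
Qed.

Section Box.
Context (R : realType) (r : nat) (a b : R).

Lemma leb_obox_lty : (leb r (obox a b : set (pt R r)) < +oo)%E.
Proof.
rewrite (leb_box (A := fun _ : 'I_r => `]a, b[%classic)).
  have lJ : (lebesgue_measure (`]a, b[%classic : set R)) \is a fin_num.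
    rewrite ge0_fin_numE//; exact: lebesgue_itv_lty.
  rewrite -ge0_fin_numE; last by apply: prode_ge0.
  by elim/big_ind: _ => // x y; exact: fin_numM.
by move=> _; exact: measurable_itv.
Qed.

End Box.

(** * Averages against the target density *)

Section TargetDensity.
Context (R : realType) (r m : nat) (a b : R) (g : pt R r -> R).
Context (hg : target_density m a b g).

Lemma target_density_ge0 x : 0 <= g x.
Proof.
have [[th [ek [th0 _ ek0 _ ->]]] _ _] := hg.
apply: sumr_ge0 => j _; apply: mulr_ge0; first exact: ltW.
by apply: prodr_ge0 => k _.
Qed.

Lemma target_density_integrable : (leb r).-integrable [set: pt R r] (EFin \o g).
Proof.
have [[th [ek [th0 ek1 _ _ gE]]] _ _] := hg.
have ij j := integrable_product_form (th j) (ek1 j).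
have -> : EFin \o g = (fun x => \sum_(j < m) (EFin \o product_form (th j) (ek j)) x)%E.
  by apply/funext => x /=; rewrite gE sumEFin.
exact: integrable_sum.
Qed.

Lemma target_density_out x : ~ obox a b x -> g x = 0.
Proof.
move=> xab; apply: contrapT => /eqP gx; apply: xab; apply: icube_obox.
by have [_ _] := hg; apply; apply: subset_closure; exists x.
Qed.

Lemma integral_target_support (h : pt R r -> R) :
  (\int[leb r]_x (g x * h x)%:E = \int[leb r]_(x in obox a b) (g x * h x)%:E)%E.
Proof.
rewrite [RHS]integral_mkcond; apply: eq_integral => x _.
rewrite /restrict; case: ifPn => // /negP xab.
by rewrite target_density_out ?mul0r// => H; apply: xab; rewrite inE.
Qed.

Lemma integrable_target_tame (h : pt R r -> R) : tame a b h ->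
  (leb r).-integrable (obox a b) (EFin \o (fun x => g x * h x)).
Proof.
move=> [mh [K hK]]; have mo := @measurable_obox R r a b.
have ig : (leb r).-integrable (obox a b) (EFin \o g).
  exact: integrableS target_density_integrable.
have := @integrable_bounded_mul _ _ _ (leb r) (obox a b) mo h g K mh hK ig.
by apply: eq_integrable => // x _ /=; rewrite mulrC.
Qed.

(** The [T] of the first functional: what remains of its first integral, up to sign, once the
    entropy of [g] is split off. *)
Definition target_mean (h : pt R r -> R) := \int[leb r]_(x in obox a b) (g x * h x).

(** Monotone because [g >= 0]; the constant [t] comes out unchanged because [g] has mass 1 on the
    open box. *)
Lemma target_mean_le h h' t : tame a b h -> tame a b h' ->
  (forall x, obox a b x -> h x <= h' x + t) -> target_mean h <= target_mean h' + t.
Proof.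
move=> th th' hh'; have mo := @measurable_obox R r a b.
have ig : (leb r).-integrable (obox a b) (EFin \o g).
  exact: integrableS target_density_integrable.
have g1 : \int[leb r]_(x in obox a b) g x = 1.
  have [_ g1 _] := hg; have := integral_target_support (fun=> 1).
  under eq_integral do rewrite mulr1; under [in X in _ = X -> _]eq_integral do rewrite mulr1.
  by rewrite g1 /Rintegral => <-.
have igt : (leb r).-integrable (obox a b) (EFin \o (fun x => t * g x)).
  exact: integrable_EFinZl.
have ih' := integrable_target_tame th'.
rewrite /target_mean -[t in _ + t]mulr1 -g1 -RintegralZl// -RintegralD//.
apply: le_Rintegral => //; first exact: integrable_target_tame.
  exact: integrable_EFinD.
move=> x xab; rewrite [t * _]mulrC -mulrDr ler_wpM2l ?target_density_ge0//.
exact: hh'.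
Qed.

End TargetDensity.

(** * Comparison of extended-real losses *)

Section Loss.
Context (R : realType) (r m : nat) (a b M1 M2 B : R) (s : R -> R -> R) (g : pt R r -> R).
Context (m_gt0 : (0 < m)%N) (ab : a < b) (hs : smoothing_kernel a b M1 M2 B s).
Context (hg : target_density m a b g).

(* If the entropy term of [e] is not integrable it is +oo, since its negative part
   is bounded; otherwise the two entropy terms differ by an integrable function. *)
Lemma loss_le e0 e : admissible a b M1 e0 -> admissible a b M1 e ->
  target_mean a b g (fun x => ln (@smoothed_mixture R r m a b s e x)) - total_mass e <=
  target_mean a b g (fun x => ln (@smoothed_mixture R r m a b s e0 x)) - total_mass e0 ->
  (loss a b s g e0 <= loss a b s g e)%E.
Proof.
have arith (u u' : \bar R) (t t' C C' : R) : u' \is a fin_num -> u \is a fin_num ->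
    fine u' = fine u + (t - t') -> t - C <= t' - C' -> (u' + C'%:E <= u + C%:E)%E.
  by case: u' => // x'; case: u => // x _ _ /= ->; rewrite lee_fin; lra.
move=> he0 he opt.
have [c0 [al0 [w0 [_ _ mass0 _]]]] := admissible_mixture ab hs m_gt0 he0.
have [c1 [al1 [w1 [_ _ mass1 _]]]] := admissible_mixture ab hs m_gt0 he.
have [t0 [K0 _ D0]] := tame_ln_smoothed_mixture ab hs m_gt0 he0.
have [t1 [K1 DK D1]] := tame_ln_smoothed_mixture ab hs m_gt0 he.
rewrite /loss mass0 mass1 !(integral_target_support hg).
have mo := @measurable_obox R r a b.
have g0 := target_density_ge0 hg.
have mg : measurable_fun (obox a b) g.
  apply: measurable_funTS; apply/measurable_EFinP.
  exact: measurable_int (target_density_integrable hg).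
(* Where [g x = 0] both sides vanish, whatever value [ln 0] takes. *)
have lnE e' x : 0 < smoothed_mixture a b s e' x ->
    g x * ln (g x / smoothed_mixture a b s e' x) =
    g x * ln (g x) - g x * ln (smoothed_mixture a b s e' x).
  move=> D'0; have [->|gx] := eqVneq (g x) 0; first by rewrite !mul0r subrr.
  by rewrite ln_div ?posrE// ?mulrBr// lt_neqAle eq_sym gx g0.
pose f x := g x * ln (g x / smoothed_mixture a b s e x).
have mf : measurable_fun (obox a b) f.
  apply: (@eq_measurable_fun _ _ _ _ _
     (fun x => g x * ln (g x) - g x * ln (smoothed_mixture a b s e x))).
    by move=> x; rewrite inE => xab; rewrite -lnE// D1.
  apply: measurable_funB; apply: measurable_funM => //; last by case: t1.
  exact: measurableT_comp.
(* With [D] the smoothed mixture, [ln q <= q] at [q = D / g] gives [g * ln (g / D) >= - D], and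
   [D <= K1]. *)
have fK x : obox a b x -> - K1 <= f x.
  move=> xab; have Dx := D1 x xab; apply: (@le_trans _ _ (- smoothed_mixture a b s e x)).
    by rewrite lerN2; exact: DK.
  rewrite /f; have [->|gx] := eqVneq (g x) 0; first by rewrite mul0r oppr_le0 ltW.
  have gx0 : 0 < g x by rewrite lt_neqAle eq_sym gx g0.
  have q0 : 0 < smoothed_mixture a b s e x / g x by rewrite divr_gt0.
  rewrite -[g x / _]invf_div lnV ?posrE// mulrN lerN2.
  apply: le_trans (ler_wpM2l (g0 x) (ltW (ln_sublinear q0))) _.
  by rewrite mulrC divfK.
have [intf|nintf] := pselect ((leb r).-integrable (obox a b) (EFin \o f)); last first.
  rewrite [X in (_ <= X + _)%E](measurable_integral_pinfty mo (leb_obox_lty r a b) mf fK nintf).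
  by rewrite addye// leey.
have i0 := integrable_target_tame hg t0; have i1 := integrable_target_tame hg t1.
have e0E : \int[leb r]_(x in obox a b) (g x * ln (g x / smoothed_mixture a b s e0 x)) =
    \int[leb r]_(x in obox a b) f x +
    (target_mean a b g (fun x => ln (smoothed_mixture a b s e x)) -
     target_mean a b g (fun x => ln (smoothed_mixture a b s e0 x))).
  rewrite /target_mean -(RintegralB mo i1 i0) -(RintegralD mo intf (integrable_EFinB mo i1 i0)).
  apply: eq_Rintegral => x; rewrite inE => xab.
  by rewrite /f !lnE ?D0 ?D1// addrA subrK.
have int0 : (leb r).-integrable (obox a b)
    (EFin \o (fun x => g x * ln (g x / smoothed_mixture a b s e0 x))).
  apply: eq_integrable (integrable_EFinD mo intf (integrable_EFinB mo i1 i0)) => //.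
  by move=> x; rewrite inE => xab /=; rewrite /f !lnE ?D0 ?D1// addrA subrK.
exact: arith (integrable_fin_num mo int0) (integrable_fin_num mo intf) e0E opt.
Qed.

End Loss.

End Auxiliary.

Theorem theorem4p6 (R : realType) (r m : nat) (a b M1 M2 B : R)
    (s : R -> R -> R) (g : pt R r -> R)
    (r_gt0 : (0 < r)%N) (m_gt0 : (0 < m)%N) (ab : a < b)
    (hs : smoothing_kernel a b M1 M2 B s)
    (hg : target_density m a b g) :
  (exists2 e0 : 'I_m -> pt R r -> R, admissible a b M1 e0 &
     forall e : 'I_m -> pt R r -> R, admissible a b M1 e ->
       (loss a b s g e0 <= loss a b s g e)%E) /\
  (forall (n : nat) (X : 'I_n -> pt R r), (0 < n)%N ->
     (forall i, icube a b (X i)) ->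
     exists2 e0 : 'I_m -> pt R r -> R, admissible a b M1 e0 &
       forall e : 'I_m -> pt R r -> R, admissible a b M1 e ->
         (loss_discrete a b s X e0 <= loss_discrete a b s X e)%E).
Proof.
split.
  have [e0 he0 opt] := exists_optimal_admissible ab hs m_gt0 (target_mean_le hg).
  by exists e0 => // e he; exact: (loss_le m_gt0 ab hs hg he0 he (opt e he)).
move=> n X n_gt0 Xin.
(* The sample average replaces [target_mean]; its [n] weights sum to 1, which lets the constant [t]
   through. *)
pose T (h : pt R r -> R) := n%:R^-1 * \sum_(i < n) h (X i).
have HT h h' t : tame a b h -> tame a b h' ->
    (forall x, obox a b x -> h x <= h' x + t) -> T h <= T h' + t.
  move=> _ _ hh'; have n0 : n%:R != 0 :> R by rewrite pnatr_eq0 -lt0n.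
  have -> : T h' + t = n%:R^-1 * \sum_(i < n) (h' (X i) + t).
    by rewrite big_split /= sumr_const card_ord mulrDr -[t *+ n]mulr_natl mulKf.
  rewrite ler_wpM2l ?invr_ge0//; apply: ler_sum => i _.
  by apply: hh'; apply: icube_obox.
have [e0 he0 opt] := exists_optimal_admissible ab hs m_gt0 HT.
exists e0; first exact: he0.
move=> e he.
have [c0 [al0 [w0 [_ _ mass0 _]]]] := admissible_mixture ab hs m_gt0 he0.
have [c1 [al1 [w1 [_ _ mass1 _]]]] := admissible_mixture ab hs m_gt0 he.
rewrite /loss_discrete mass0 mass1 -!EFinD lee_fin -lerN2 !opprD !opprK.
exact: opt e he.
Qed.
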